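(* \textsc{Bicolored $P_3$ Deletion} can be solved in $\mathcal{O}(n)$ time on instances $(G,k)$ where $G$ contains no monochromatic $K_3$ and no monochromatic $P_3$ as induced subgraphs, where $n=|V|$.
   Context: A two-colored graph $G=(V,E_r,E_b)$ is a finite simple undirected graph whose edge set $E=E_r\uplus E_b$ is partitioned into red and blue edges. A bicolored $P_3$ is an induced path on three vertices $u,v,w$ (edges $\{u,v\},\{v,w\}$, non-edge $\{u,w\}$) whose two edges have different colors; a monochromatic $P_3$ is such an induced path whose two edges have the same color. A monochromatic $K_3$ is a triangle all three of whose edges have the same color. \textsc{Bicolored $P_3$ Deletion}: given a two-colored graph $G$ and an integer $k\in\mathbb{N}$, decide whether there is a set $S\subseteq E$ with $|S|\le k$ such that $G-S$ contains no bicolored $P_3$ as an induced subgraph. *)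

(* Defs.v *)
From mathcomp Require Import all_boot.
Set Implicit Arguments. Unset Strict Implicit. Unset Printing Implicit Defensive.

Record tcgraph (n : nat) := TCGraph {
  red  : {set {set 'I_n}};
  blue : {set {set 'I_n}} }.

Definition edge n (x y : 'I_n) : {set 'I_n} := [set x; y].

Definition wf_tcgraph n (G : tcgraph n) : Prop :=
  [/\ (forall e, e \in red G -> #|e| = 2),
      (forall e, e \in blue G -> #|e| = 2) &
      [disjoint red G & blue G]].

Definition induced_P3 n (R B A C : {set {set 'I_n}}) : Prop :=
  exists u v w : 'I_n,
    [/\ u != w, edge u v \in A, edge v w \in C & edge u w \notin R :|: B].

Definition has_bicolored_P3 n (R B : {set {set 'I_n}}) : Prop :=
  induced_P3 R B R B.

Definition has_mono_P3 n (G : tcgraph n) : Prop :=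
  induced_P3 (red G) (blue G) (red G) (red G) \/
  induced_P3 (red G) (blue G) (blue G) (blue G).

Definition mono_triangle n (A : {set {set 'I_n}}) : Prop :=
  exists u v w : 'I_n,
    [/\ [&& u != v, v != w & u != w],
        edge u v \in A, edge v w \in A & edge u w \in A].

Definition has_mono_K3 n (G : tcgraph n) : Prop :=
  mono_triangle (red G) \/ mono_triangle (blue G).

Definition bp3d_yes n (G : tcgraph n) (k : nat) : Prop :=
  exists S : {set {set 'I_n}},
    [/\ S \subset red G :|: blue G, #|S| <= k &
        ~ has_bicolored_P3 (red G :\: S) (blue G :\: S)].

Inductive instr :=
| IConst of nat & nat
| IAdd of nat & nat & nat
| ISub of nat & nat & nat
| ILoad of nat & nat
| IStore of nat & nat
| IJz of nat & nat
| IJmp of nat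
| IHalt.

Record config := Cfg { cfg_pc : nat; cfg_mem : nat -> nat }.

Definition upd (m : nat -> nat) (r v : nat) : nat -> nat :=
  fun i => if i == r then v else m i.

(* one step; None if the machine has halted (IHalt or pc out of range) *)
Definition step (P : seq instr) (c : config) : option config :=
  let: Cfg pc m := c in
  match nth IHalt P pc with
  | IConst r v => Some (Cfg pc.+1 (upd m r v))
  | IAdd r a b => Some (Cfg pc.+1 (upd m r (m a + m b)))
  | ISub r a b => Some (Cfg pc.+1 (upd m r (m a - m b)))
  | ILoad r a => Some (Cfg pc.+1 (upd m r (m (m a))))
  | IStore a b => Some (Cfg pc.+1 (upd m (m a) (m b)))
  | IJz a l => Some (Cfg (if m a == 0 then l else pc.+1) m)
  | IJmp l => Some (Cfg l m)
  | IHalt => None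
  end.

Fixpoint exec (P : seq instr) (t : nat) (c : config) : option config :=
  match step P c with
  | None => Some c
  | Some c' => if t is t'.+1 then exec P t' c' else None
  end.

Definition init (inp : seq nat) : config := Cfg 0 (fun i => nth 0 inp i).

(* An edge list: each edge {u,v} appears exactly once as (u, v, color),
   color false = red, true = blue; any order/orientation is allowed. *)
Definition valid_edge_list n (G : tcgraph n) (es : seq ('I_n * 'I_n * bool)) : Prop :=
  let L := [seq (edge x.1.1 x.1.2, x.2) | x <- es] in
  [/\ uniq L,
      (forall e, (e, false) \in L <-> e \in red G) &
      (forall e, (e, true) \in L <-> e \in blue G)].

Definition encode n (k : nat) (es : seq ('I_n * 'I_n * bool)) : seq nat :=
  [:: n; k; size es] ++
  flatten [seq [:: val x.1.1; val x.1.2; nat_of_bool x.2] | x <- es].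

(* Main.v *)
Require Import Defs.
From mathcomp Require Import all_boot zify.
Set Implicit Arguments. Unset Strict Implicit. Unset Printing Implicit Defensive.

(* Two neighbours of a vertex along one colour are joined by an edge of the other
   colour; hence every vertex has at most two red and two blue neighbours, and
   there are O(n) edges.  Call a vertex a center if it is the middle of a bicolored
   P3, and link two adjacent centers if the edge between them is in conflict at
   both.  Links lie in no triangle and form alternating paths and cycles.  Greedy
   peeling of paths from their ends yields a set of links and single centers to
   delete together with a half-integral packing of bicolored P3s of equal value;
   a center with two neighbours of each colour costs one deletion more.  Twice the
   optimum is the sum of the costs of the centers plus the number of singles, and
   it is found by three loops with loop-free bodies, written in a small structured
   language that is compiled to the RAM. *)

(** * Local structure and weak duality *)

(** Deleting an edge can turn a triangle into a new bicolored P3, and this obstacle shapes the local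
    analysis: links are safe because they lie in no triangle, and the edges removed at the remaining
    centers are chosen so that a triangle losing one of them loses two. What is left is a minimum
    cover of the centers by links and single vertices, whose dual is a maximum independent set in a
    graph of paths and even cycles. On a path, each removed end gets weight 2 and its neighbour
    weight 0. A cycle has no end to start from, but weight 1 on all its vertices already equals
    twice the size of a perfect matching, so the algorithm never walks round a cycle. This is why
    all values are doubled. On the machine, the input occupies the very cells needed as registers,
    and there is neither multiplication nor an address offset; hence the relocation by repeated
    doubling and the records of eight cells. *)

Record mono_free (n : nat) (r b : rel 'I_n) : Prop := MonoFree {
  mf_rsym : symmetric r;
  mf_bsym : symmetric b;
  mf_rirr : irreflexive r;
  mf_birr : irreflexive b;
  mf_disj : forall x y, r x y -> ~~ b x y;
  mf_red : forall x y z, r x y -> r x z -> y != z -> b y z;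
  mf_blue : forall x y z, b x y -> b x z -> y != z -> r y z }.

(** The record treats both colours alike, so facts proved for red transfer to blue. Its last two
    fields each merge both hypotheses on the graph: no monochromatic P3 makes the two neighbours
    adjacent, no monochromatic triangle fixes the colour. *)
Lemma mono_free_swap n (r b : rel 'I_n) : mono_free r b -> mono_free b r.
Proof. by case=> *; split=> // x y h; apply/negP=> h'; move: h; apply/negP; auto. Qed.

Section LocalStructure.
Variable n : nat.
Implicit Types (r b : rel 'I_n) (u v w x y z a c : 'I_n).

Definition adj r b x y := r x y || b x y.
Definition cpair r b v a c := [&& r v a, b v c & ~~ adj r b a c].
Definition center r b v := [exists a, [exists c, cpair r b v a c]].
Definition lone r v w := r v w && [forall z, r v z ==> (z == w)].
Definition mixed r b v := center r b v &&
  [exists a, [exists c, [&& r v a, b v c & adj r b a c]]].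
Definition deg r v := #|[set x | r v x]|.
(** Two triangles sharing [v], the shape of a bow tie. By [mixed_not_bow] no red neighbour is
    adjacent to a blue one, so all four red-blue pairs are conflicts and one deletion cannot settle
    [v]. *)
Definition bow r b v := [&& center r b v, 1 < deg r v & 1 < deg b v].
Definition conf r b v := [set x | [exists y, cpair r b v x y || cpair r b v y x]].
(** At a center, the edge to the only neighbour along a colour belongs to every conflict, so
    deleting it settles the center; by [linked_sym] it settles both ends. This form can be read off
    from local data, and [linked_of_conf] recovers it from an edge in conflict at both ends. *)
Definition linked r b v w :=
  [&& center r b v, center r b w & lone r v w || lone b v w].

Lemma centerP r b v : reflect (exists a c, cpair r b v a c) (center r b v).
Proof.
apply: (iffP existsP) => [[a /existsP[c h]]|[a [c h]]]; first by exists a, c.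
by exists a; apply/existsP; exists c.
Qed.

Lemma loneP r v w : reflect (r v w /\ forall z, r v z -> z = w) (lone r v w).
Proof.
apply: (iffP andP) => [[h /forallP h2]|[h h2]]; split=> //.
  by move=> z hz; have /implyP/(_ hz)/eqP := h2 z.
by apply/forallP=> z; apply/implyP=> /h2/eqP.
Qed.

Lemma mixedP r b v : reflect (center r b v /\
  exists a c, [/\ r v a, b v c & adj r b a c]) (mixed r b v).
Proof.
apply: (iffP andP) => [[h /existsP[a /existsP[c /and3P[? ? ?]]]]|[h [a [c [? ? ?]]]]].
  by split=> //; exists a, c.
by split=> //; apply/existsP; exists a; apply/existsP; exists c; apply/and3P.
Qed.

Lemma adj_sym r b : mono_free r b -> symmetric (adj r b).
Proof. by move=> H x y; rewrite /adj (mf_rsym H) (mf_bsym H). Qed.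

Lemma adj_irr r b : mono_free r b -> irreflexive (adj r b).
Proof. by move=> H x; rewrite /adj (mf_rirr H) (mf_birr H). Qed.

Lemma adj_swap r b x y : adj b r x y = adj r b x y.
Proof. by rewrite /adj orbC. Qed.

Lemma cpair_swap r b v a c : mono_free r b -> cpair b r v a c = cpair r b v c a.
Proof.
by move=> H; rewrite /cpair adj_swap (adj_sym H a c) andbCA.
Qed.

Lemma center_swap r b v : mono_free r b -> center b r v = center r b v.
Proof.
by move=> H; apply/centerP/centerP => -[a [c]]; [rewrite cpair_swap // | rewrite -cpair_swap //];
  exists c, a.
Qed.

Lemma mixed_swap r b v : mono_free r b -> mixed b r v = mixed r b v.
Proof.
move=> H; apply/mixedP/mixedP => -[h [a [c [h1 h2 h3]]]].
  split; first by rewrite -center_swap.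
  by exists c, a; rewrite (adj_sym H) -adj_swap.
split; first by rewrite center_swap.
by exists c, a; rewrite adj_swap (adj_sym H).
Qed.

(** Three distinct red neighbours would be pairwise joined in blue, a blue triangle. *)
Lemma red_degree r b v x y z : mono_free r b -> r v x -> r v y -> r v z ->
  x != y -> x != z -> y = z.
Proof.
move=> H hx hy hz xy xz; apply/eqP/negPn/negP => yz.
have := mf_disj H (mf_blue H (mf_red H hx hy xy) (mf_red H hx hz xz) yz).
by rewrite (mf_red H hy hz yz).
Qed.

(** Another red neighbour [z] of [w] would be a blue neighbour of [v], hence joined to [c] in red;
    then [w] and [c] are both red neighbours of [z] and so adjacent. *)
Lemma conflict_lone r b v w c : mono_free r b ->
  r v w -> b v c -> ~~ adj r b c w -> lone r w v.
Proof.
move=> H vw vc ncw; apply/loneP; rewrite (mf_rsym H); split=> // z wz.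
apply/eqP/negPn/negP => zv; rewrite eq_sym in zv.
have bvz : b v z by apply: (mf_red H _ wz zv); rewrite (mf_rsym H).
have cz : c != z.
  by apply: contraNneq ncw => ->; rewrite (adj_sym H) /adj wz.
have zc : r z c by rewrite (mf_rsym H); apply: (mf_blue H vc bvz cz).
have cw : c != w.
  by apply: contraTneq vw => <-; apply: contraTN vc; apply: mf_disj.
case/negP: ncw; rewrite /adj (mf_red H zc _ cw) ?orbT //.
by rewrite (mf_rsym H).
Qed.

(** By [conflict_lone] at both ends, a common neighbour [z] sees [v] and [w] in blue. Then [z] is
    joined to [c] and [c'] in red, so [c c'] is blue, and [c] has the blue neighbours [v] and [c'],
    which must be adjacent. *)
Lemma conflict_no_triangle r b v w c c' z : mono_free r b ->
  r v w -> b v c -> ~~ adj r b c w -> b w c' -> ~~ adj r b c' v ->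
  adj r b v z -> adj r b w z -> False.
Proof.
move=> H vw vc ncw wc' nc'v.
have /loneP[wv Lw] := conflict_lone H vw vc ncw.
have /loneP[_ Lv] := conflict_lone H wv wc' nc'v.
case/orP=> [/Lv->|vz]; first by rewrite (adj_irr H).
case/orP=> [/Lw zv|wz]; first by rewrite zv (mf_birr H) in vz.
have cz : c != z by apply: contraNneq ncw => ->; rewrite /adj (mf_bsym H z) wz orbT.
have c'z : c' != z by apply: contraNneq nc'v => ->; rewrite /adj (mf_bsym H z) vz orbT.
have rcz := mf_blue H vc vz cz.
have rc'z := mf_blue H wc' wz c'z.
have cc' : c != c'.
  by apply: contraNneq ncw => ->; rewrite /adj (mf_bsym H c') wc' orbT.
rewrite (mf_rsym H) in rcz; rewrite (mf_rsym H) in rc'z.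
have bcc' := mf_red H rcz rc'z cc'.
rewrite (mf_bsym H) in vc.
case/negP: nc'v; rewrite /adj (mf_blue H bcc' vc) //.
apply: contraTneq vw => <-; rewrite (mf_rsym H).
by apply: contraTN wc'; apply: mf_disj.
Qed.

Lemma linked_sym r b v w : mono_free r b -> linked r b v w -> linked r b w v.
Proof.
move=> H /and3P[cv cw /orP[] l]; apply/and3P; split=> //; case/loneP: l => vw l.
  apply/orP; left; case/centerP: cv => a [c /and3P[va vc nac]].
  by rewrite (l _ va) in nac; apply: (conflict_lone H vw vc _); rewrite (adj_sym H).
apply/orP; right; case/centerP: cv => a [c /and3P[va vc nac]].
have H' := mono_free_swap H.
by rewrite (l _ vc) in nac; apply: (conflict_lone H' vw va _); rewrite adj_swap.
Qed.

(** This makes the deletion of links harmless: removing an edge creates an induced P3 only out of a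
    triangle through that edge. *)
Lemma linked_no_triangle r b v w z : mono_free r b -> linked r b v w ->
  adj r b v z -> adj r b w z -> False.
Proof.
move=> H l; have := linked_sym H l; case/and3P: l => cv cw lvw /and3P[_ _ lwv].
have [a [c /and3P[va vc nac]]] := centerP _ _ _ cv.
have [a' [c' /and3P[wa' wc' nac']]] := centerP _ _ _ cw.
case/orP: lvw => /loneP[vw Lv].
  case/orP: lwv => /loneP[wv Lw]; last by rewrite (mf_rsym H) in vw; move: (mf_disj H vw); rewrite wv.
  rewrite (Lv _ va) in nac; rewrite (Lw _ wa') in nac'.
  by apply: (conflict_no_triangle H vw vc _ wc'); rewrite (adj_sym H).
case/orP: lwv => /loneP[wv Lw]; first by rewrite (mf_bsym H) in vw; move: (mf_disj H wv); rewrite vw.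
rewrite (Lv _ vc) in nac; rewrite (Lw _ wc') in nac'.
have H' := mono_free_swap H.
rewrite -!(adj_swap r b).
by apply: (conflict_no_triangle H' vw va _ wa'); rewrite adj_swap.
Qed.

Lemma linked_of_conf r b v w : mono_free r b ->
  w \in conf r b v -> v \in conf r b w -> linked r b v w.
Proof.
move=> H; rewrite !inE => /existsP[y h] /existsP[z h'].
have cv : center r b v by apply/centerP; case/orP: h => h; [exists w, y | exists y, w].
have cw : center r b w by apply/centerP; case/orP: h' => h'; [exists v, z | exists z, v].
apply/and3P; split=> //; case/orP: h => /and3P[h1 h2 h3].
  case/orP: h' => /and3P[h1' h2' h3']; last first.
    by move: (mf_disj H h1); rewrite (mf_bsym H) h2'.
  by rewrite (conflict_lone H h1' h2') // (adj_sym H).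
case/orP: h' => /and3P[h1' h2' h3'].
  by rewrite (mf_rsym H) in h1'; move: (mf_disj H h1'); rewrite h2.
by rewrite (conflict_lone (mono_free_swap H) h2' h1') ?orbT // adj_swap.
Qed.

(** The edge [c c'] is red, which forces [a c'] to be blue. A second red neighbour [z] of [v] would
    be joined to [a] in blue, then to [c'] in red, then to [c] in blue, and [z] would make [a] and
    [c] adjacent. *)
Lemma mixed_lone r b v a c c' : mono_free r b -> r v a -> b v c -> b v c' ->
  ~~ adj r b a c -> adj r b a c' -> lone r v a.
Proof.
move=> H va vc vc' nac ac'.
have cc' : c' != c by apply: contraTneq ac' => ->.
have rcc' := mf_blue H vc' vc cc'.
have ac : a != c by apply: contraTneq va => ->; apply: contraTN vc; apply: mf_disj.
have bac' : b a c'.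
  case/orP: ac' => // ac'; rewrite (mf_rsym H) in ac'.
  by case/negP: nac; rewrite /adj (mf_red H ac' rcc' ac) orbT.
apply/loneP; split=> // z vz; apply/eqP/negPn/negP => za.
have bza := mf_red H vz va za.
have zc : z != c by apply: contraTneq vz => ->; apply: contraTN vc; apply: mf_disj.
have zc' : z != c' by apply: contraTneq vz => ->; apply: contraTN vc'; apply: mf_disj.
rewrite (mf_bsym H) in bza.
have rzc' := mf_blue H bza bac' zc'.
rewrite (mf_rsym H) in rzc'.
have bzc := mf_red H rzc' rcc' zc.
rewrite (mf_bsym H) in bza; rewrite /adj (mf_blue H bza bzc ac) in nac.
by [].
Qed.

(** If both vertices differ, then [a a'] is blue and [c c'] is red, and an edge [a' c'] of either
    colour propagates to an edge [a c]. *)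
Lemma mixed_cases r b v a c a' c' : mono_free r b -> r v a -> b v c ->
  ~~ adj r b a c -> r v a' -> b v c' -> adj r b a' c' -> a' = a \/ c' = c.
Proof.
move=> H va vc nac va' vc' ac'.
case: (eqVneq a' a) => [->|aa]; first by left.
case: (eqVneq c' c) => [->|cc]; first by right.
have baa := mf_red H va' va aa; have rcc := mf_blue H vc' vc cc.
have n1 x y : r v x -> b v y -> x != y.
  by move=> hx hy; apply: contraTneq hx => ->; apply: contraTN hy; apply: mf_disj.
case/orP: ac' => ac'.
  have ac2 := ac'; rewrite (mf_rsym H) in ac2.
  have bac := mf_red H ac2 rcc (n1 _ _ va' vc).
  by rewrite /adj (mf_blue H baa bac (n1 _ _ va vc)) in nac.
have rac := mf_blue H baa ac' (n1 _ _ va vc').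
rewrite (mf_rsym H) in rac.
by rewrite /adj (mf_red H rac rcc (n1 _ _ va vc)) orbT in nac.
Qed.

(** By [mixed_cases] the adjacent pair shares a vertex with the conflict. By [mixed_lone] that
    vertex is the only neighbour along its colour, and of the at most two along the other colour,
    one is adjacent to it. *)
Lemma mixed_unique r b v a c a2 c2 : mono_free r b -> mixed r b v ->
  cpair r b v a c -> cpair r b v a2 c2 -> a2 = a /\ c2 = c.
Proof.
move=> H /mixedP[_ [a' [c' [va' vc' ac']]]].
move=> /and3P[va vc nac] /and3P[va2 vc2 nac2].
have H' := mono_free_swap H.
case: (eqVneq c' c) => [e|cc]; last first.
  have [e|/eqP] := mixed_cases H va vc nac va' vc' ac'; last by rewrite (negbTE cc).
  rewrite e in va' ac'; have /loneP[_ L] := mixed_lone H va vc vc' nac ac'.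
  have e2 := L _ va2; split=> //; rewrite e2 in nac2.
  apply/esym; apply: (red_degree H' vc' vc vc2 cc).
  by apply: contraTneq ac' => ->.
rewrite e in vc' ac'.
have nca : ~~ adj b r c a by rewrite adj_swap (adj_sym H).
have ca' : adj b r c a' by rewrite adj_swap (adj_sym H).
have /loneP[_ L] := mixed_lone H' vc va va' nca ca'.
have e2 := L _ vc2; split=> //; rewrite e2 in nac2.
have aa : a' != a by apply: contraTneq ac' => ->.
apply/esym; apply: (red_degree H va' va va2 aa).
by apply: contraTneq ac' => ->.
Qed.

Lemma deg_le2 r b v : mono_free r b -> deg r v <= 2.
Proof.
move=> H; rewrite leqNgt; apply/negP=> h.
have [x hx] : exists x, x \in [set x | r v x] by apply/card_gt0P; apply: leq_trans h.
rewrite /deg (cardsD1 x) hx add1n ltnS in h.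
have [y hy] : exists y, y \in [set x | r v x] :\ x by apply/card_gt0P; apply: leq_trans h.
rewrite (cardsD1 y) hy add1n ltnS in h.
have [z hz] : exists z, z \in [set x | r v x] :\ x :\ y by apply/card_gt0P.
move: hx hy hz; rewrite !inE => hx /andP[yx hy] /and3P[zy zx hz].
have e : y = z by apply: (red_degree H hx hy hz); rewrite eq_sym.
by rewrite e eqxx in zy.
Qed.

Lemma mixed_not_bow r b v : mono_free r b -> mixed r b v -> ~~ bow r b v.
Proof.
move=> H /mixedP[/centerP[a [c /and3P[va vc nac]]] [a' [c' [va' vc' ac']]]].
have lone1 s w : lone s v w -> ~~ (1 < deg s v).
  case/loneP=> _ L; rewrite -leqNgt /deg -(cards1 w); apply: subset_leq_card.
  by apply/subsetP=> z; rewrite !inE => /L->.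
have [e|e] := mixed_cases H va vc nac va' vc' ac'.
  rewrite e in ac'; rewrite /bow (negbTE (lone1 _ _ (mixed_lone H va vc vc' nac ac'))).
  by rewrite andbF.
rewrite e in ac'.
have nca : ~~ adj b r c a by rewrite adj_swap (adj_sym H).
have ca' : adj b r c a' by rewrite adj_swap (adj_sym H).
have l := mixed_lone (mono_free_swap H) vc va va' nca ca'.
by rewrite /bow (negbTE (lone1 _ _ l)) !andbF.
Qed.

(* Endpoints of the edges deleted at a center that is not covered by a link.
   The only mixed centers are the two middle vertices of a diamond; ordering the
   two ends of their common conflict makes both of them isolate the same end. *)
Definition sel r b v : {set 'I_n} :=
  if mixed r b v then
    [set x : 'I_n | [exists y : 'I_n, (x < y) && (cpair r b v x y || cpair r b v y x)]]
  else if deg r v <= 1 then [set x | r v x] else [set x | b v x].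

Lemma sel_card r b v : mono_free r b -> center r b v -> #|sel r b v| <= 1 + bow r b v.
Proof.
move=> H cv; rewrite /sel; case: ifP => m.
  rewrite (leq_trans _ (leq_addr _ _)) //; apply/card_le1_eqP => x y.
  rewrite !inE => /existsP[x' /andP[lx hx]] /existsP[y' /andP[ly hy]].
  have U := mixed_unique H m.
  case/orP: hx => hx; case/orP: hy => hy; have [e1 e2] := U _ _ _ _ hx hy.
  - by rewrite e1.
  - by move: lx ly; rewrite e1 e2 => h1 h2; have := ltn_trans h1 h2; rewrite ltnn.
  - by move: lx ly; rewrite e1 e2 => h1 h2; have := ltn_trans h1 h2; rewrite ltnn.
  - by rewrite e2.
case: ifP => dr; first exact: leq_trans dr (leq_addr _ _).
rewrite /bow cv ltnNge dr /=; rewrite -/(deg b v).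
by have := deg_le2 v (mono_free_swap H); case: (deg b v) => [|[|[|]]].
Qed.

Lemma sel_cover r b v a c : mono_free r b -> cpair r b v a c ->
  (a \in sel r b v) || (c \in sel r b v).
Proof.
move=> H h; have /and3P[va vc nac] := h; rewrite /sel; case: ifP => m.
  rewrite !inE; case: (ltngtP a c) => ac.
  - by apply/orP; left; apply/existsP; exists c; rewrite ac h.
  - by apply/orP; right; apply/existsP; exists a; rewrite ac h orbT.
  - by move: (mf_disj H va); rewrite (ord_inj ac) vc.
by case: ifP => _; rewrite !inE ?va ?vc ?orbT.
Qed.

Lemma sel_triangle_red r b u x y z : mono_free r b -> mixed r b u ->
  cpair r b u x y -> adj r b u z -> adj r b x z ->
  [/\ mixed r b z, cpair r b z x y || cpair r b z y x & adj r b z y].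
Proof.
move=> H m h uz xz; have /and3P[ux uy nxy] := h.
have n1 v w t : r t v -> b t w -> v != w.
  by move=> hx hy; apply: contraTneq hx => ->; apply: contraTN hy; apply: mf_disj.
have zx : z != x by apply: contraTneq xz => ->; rewrite (adj_irr H).
have zy : z != y by apply: contraTneq xz => ->.
have ux' : adj r b u x by rewrite /adj ux.
have uy' : adj r b u y by rewrite /adj uy orbT.
have key : cpair r b z y x -> mixed r b z -> [/\ mixed r b z, cpair r b z x y || cpair r b z y x & adj r b z y].
  by move=> hc hm; split=> //; [rewrite hc orbT | rewrite /adj; case/and3P: hc => ->].
case/orP: uz => uz.
  have bzx := mf_red H uz ux zx.
  have : adj r b z y.
    apply/negPn/negP=> nzy; have hz : cpair r b u z y by rewrite /cpair uz uy.
    by have [e _] := mixed_unique H m h hz; rewrite e eqxx in zx.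
  case/orP => zy'; last first.
    by rewrite /adj (mf_blue H bzx zy' (n1 _ _ _ ux uy)) in nxy.
  have hc : cpair r b z y x by rewrite /cpair zy' bzx (adj_sym H).
  apply: key => //; apply/mixedP; split; first by apply/centerP; exists y, x.
  by exists u, x; split=> //; rewrite (mf_rsym H).
have rzy := mf_blue H uz uy zy.
have bzx : b z x.
  case/orP: xz => xz; last by rewrite (mf_bsym H).
  rewrite (mf_rsym H) in xz.
  by rewrite /adj (mf_red H xz rzy (n1 _ _ _ ux uy)) orbT in nxy.
have hc : cpair r b z y x by rewrite /cpair rzy bzx (adj_sym H).
apply: key => //; apply/mixedP; split; first by apply/centerP; exists y, x.
by exists y, u; split=> //; rewrite ?(mf_bsym H z) // (adj_sym H).
Qed.

(** A triangle that loses [u x] loses a second edge. If [u] is not mixed, [z] has the colour of [x]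
    at [u] and is selected too. If [u] is mixed, [z] is the other middle of the diamond and selects
    [x]; both its conflict edges lie in triangles, so it has no link and must be treated as a single
    center. *)
Lemma sel_triangle r b u x z : mono_free r b -> center r b u ->
  x \in sel r b u -> adj r b u z -> adj r b x z -> z \in sel r b u \/
  [/\ center r b z, x \in sel r b z & forall w, ~~ linked r b z w].
Proof.
move=> H cu; rewrite {1 2}/sel; case: ifP => m; last first.
  move=> hx uz xz; left; move: hx.
  have nm a c : r u a -> b u c -> ~~ adj r b a c.
    move=> ua uc; apply/negP=> ac; move/negP: m; apply; apply/mixedP; split=> //.
    by exists a, c.
  case: ifP => d; rewrite !inE => ux; case/orP: uz => // uz.
    by have := nm _ _ ux uz; rewrite xz.
  by have := nm _ _ uz ux; rewrite (adj_sym H) xz.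
rewrite inE => /existsP[y /andP[lxy hx]] uz xz; right.
have [mz cz zy] : [/\ mixed r b z, cpair r b z x y || cpair r b z y x & adj r b z y].
  case/orP: hx => hx; first exact: (sel_triangle_red H m hx uz xz).
  have H' := mono_free_swap H.
  rewrite -(mixed_swap _ H) in m; rewrite -cpair_swap // in hx.
  rewrite -adj_swap in uz; rewrite -adj_swap in xz.
  have [] := sel_triangle_red H' m hx uz xz.
  by rewrite (mixed_swap _ H) !(cpair_swap _ _ _ H) adj_swap orbC.
have cz' : center r b z by case/mixedP: mz.
split=> //.
  by rewrite /sel mz inE; apply/existsP; exists y; rewrite lxy cz.
have uy : adj r b u y.
  by case/orP: hx => /and3P[h1 h2 _]; rewrite /adj ?h1 // h2 orbT.
have ux : adj r b u x.
  by case/orP: hx => /and3P[h1 h2 _]; rewrite /adj ?h1 // h2 orbT.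
have zu : adj r b z u by rewrite (adj_sym H).
move=> w; apply/negP=> l; have hl := linked_no_triangle H l zu.
have hwx : w != x by apply: contra_notN hl => /eqP->; rewrite (adj_sym H).
have hwy : w != y by apply: contra_notN hl => /eqP->; rewrite (adj_sym H).
case/and3P: l => _ _ /orP[]/loneP[_ L]; case/orP: cz => /and3P[h1 h2 _].
- by rewrite (L _ h1) eqxx in hwx.
- by rewrite (L _ h1) eqxx in hwy.
- by rewrite (L _ h2) eqxx in hwy.
- by rewrite (L _ h2) eqxx in hwx.
Qed.

(** * Lower bound: sets hitting all conflicts, and packings *)

Lemma edge_inj v x y : edge v x = edge v y -> x = y.
Proof.
move=> e; have : x \in edge v y by rewrite -e !inE eqxx orbT.
have : y \in edge v x by rewrite e !inE eqxx orbT.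
by rewrite !inE => /orP[/eqP yv|/eqP-> //] /orP[/eqP xv|/eqP //]; rewrite xv yv.
Qed.

Lemma edgeC v w : edge v w = edge w v.
Proof. exact: setUC. Qed.

Definition hits r b (S : {set {set 'I_n}}) :=
  forall v a c, cpair r b v a c -> (edge v a \in S) || (edge v c \in S).

Definition local_hits r b (S : {set {set 'I_n}}) v :=
  [set e in S | [exists x, (x \in conf r b v) && (e == edge v x)]].

Lemma conf_cpair r b v a c : cpair r b v a c -> (a \in conf r b v) && (c \in conf r b v).
Proof.
by move=> h; rewrite !inE; apply/andP; split; apply/existsP; [exists c | exists a]; rewrite h ?orbT.
Qed.

Lemma local_hits_in r b (S : {set {set 'I_n}}) v x : edge v x \in S -> x \in conf r b v ->
  edge v x \in local_hits r b S v.
Proof. by move=> h1 h2; rewrite inE h1; apply/existsP; exists x; rewrite h2 /=. Qed.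

Lemma local_hits_card r b S v : mono_free r b -> hits r b S -> center r b v ->
  1 + bow r b v <= #|local_hits r b S v|.
Proof.
move=> H hS cv; have [a [c h]] := centerP _ _ _ cv.
have /andP[ca cc] := conf_cpair h.
case bv: (bow r b v); last first.
  apply/card_gt0P; case/orP: (hS _ _ _ h) => hs.
    by exists (edge v a); apply: local_hits_in.
  by exists (edge v c); apply: local_hits_in.
have /and3P[va vc nac] := h.
have nm a' c' : r v a' -> b v c' -> cpair r b v a' c'.
  move=> h1 h2; rewrite /cpair h1 h2; apply/negP=> h3.
  have /(mixed_not_bow H) : mixed r b v by apply/mixedP; split=> //; exists a', c'.
  by rewrite bv.
have other (s : rel 'I_n) x : s v x -> 1 < deg s v -> exists2 x', s v x' & x' != x.
  move=> sx; rewrite /deg (cardsD1 x) inE sx => /card_gt0P[x'].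
  by rewrite !inE => /andP[h1 h2]; exists x'.
have two x y : x != y -> x \in conf r b v -> y \in conf r b v ->
    edge v x \in S -> edge v y \in S -> 1 < #|local_hits r b S v|.
  move=> xy hx hy sx sy; rewrite (cardsD1 (edge v x)) local_hits_in // ltnS.
  apply/card_gt0P; exists (edge v y); rewrite in_setD1 local_hits_in // andbT.
  by apply: contraNneq xy => /edge_inj->.
case/and3P: bv => _ dr db.
have [a' va' aa] := other _ _ va dr; have [c' vc' cc'] := other _ _ vc db.
have h11 := nm _ _ va vc; have h12 := nm _ _ va vc'; have h21 := nm _ _ va' vc.
have h22 := nm _ _ va' vc'.
have /andP[ca' cc2] := conf_cpair h22.
have := hS _ _ _ h11; have := hS _ _ _ h12; have := hS _ _ _ h21; have := hS _ _ _ h22.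
(* The four conflicts form a 4-cycle on the edges at [v]; a set hitting them all contains both red
   or both blue edges. *)
case sa: (edge v a \in S); case sa': (edge v a' \in S) => /=.
- by move=> *; apply: two aa _ _ _ _.
- by move=> s1 s2 _ _; apply: two cc' _ _ _ _.
- by move=> _ _ s1 s2; apply: two cc' _ _ _ _.
- by move=> s1 s2 _ _; apply: two cc' _ _ _ _.
Qed.

(* Half-integral weak duality: the weights [y] form a fractional packing of the
   conflicts, and [S] hits all of them. *)
Lemma packing_bound r b (S : {set {set 'I_n}}) (y : 'I_n -> nat) : mono_free r b -> hits r b S ->
  (forall v, y v <= 2) -> (forall v w, linked r b v w -> y v + y w <= 2) ->
  \sum_(v | center r b v) y v * (1 + bow r b v) <= 2 * #|S|.
Proof.
move=> H hS y2 yl.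
apply: leq_trans (_ : \sum_(v | center r b v) \sum_(e in local_hits r b S v) y v <= _).
  apply: leq_sum => v cv; rewrite sum_nat_const mulnC leq_mul2r.
  by rewrite local_hits_card ?orbT.
apply: leq_trans (_ : \sum_v \sum_(e in local_hits r b S v) y v <= _).
  by rewrite [X in _ <= X](bigID (center r b)) leq_addr.
rewrite (exchange_big_dep (mem S)) /=; last by move=> v e _; rewrite inE => /andP[].
rewrite mulnC -sum_nat_const; apply: leq_sum => e eS.
(* An edge of [S] is counted only at its two ends, and at both only if it is a link; either way it
   collects weight at most 2. *)
case: (pickP (fun v => e \in local_hits r b S v)) => [v hv|h0]; last first.
  by rewrite big_pred0.
rewrite (bigD1 v) //=; have := hv; rewrite inE => /andP[_ /existsP[x /andP[cx /eqP ex]]].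
case: (pickP (fun w => (e \in local_hits r b S w) && (w != v))) => [w /andP[hw wv]|h0]; last first.
  by rewrite big_pred0 ?addn0.
have w_in : forall u, e \in local_hits r b S u -> u \in edge v x.
  move=> u; rewrite inE => /andP[_ /existsP[z /andP[_ /eqP e2]]].
  by rewrite -ex e2 !inE eqxx.
have wx : w = x by have := w_in _ hw; rewrite !inE (negbTE wv) => /eqP.
rewrite (bigD1 w) ?hw ?wv //= big_pred0 ?addn0; last first.
  move=> u; apply/negbTE/negP=> /andP[/andP[hu uv] uw].
  by have := w_in _ hu; rewrite !inE (negbTE uv) -wx (negbTE uw).
apply: yl; rewrite wx; apply: linked_of_conf => //.
move: hw; rewrite inE => /andP[_ /existsP[z /andP[cz /eqP e2]]].
suff -> : v = z by rewrite -wx.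
by apply: (@edge_inj w); rewrite -e2 ex wx edgeC.
Qed.

Definition deletion r b (E2 : {set {set 'I_n}}) (T : {set 'I_n}) :=
  E2 :|: \bigcup_(v in T) [set edge v x | x in sel r b v].

Lemma deletion_card r b E2 (T : {set 'I_n}) : mono_free r b ->
  (forall v, v \in T -> center r b v) ->
  #|deletion r b E2 T| <= #|E2| + #|T| + #|[set v | bow r b v]|.
Proof.
move=> H hT; rewrite -addnA; apply: leq_trans (leq_card_setU _ _) _; rewrite leq_add2l.
apply: leq_trans (_ : \sum_(v in T) (1 + bow r b v) <= _).
  elim/big_rec2: _ => [|v m X vT le]; first by rewrite cards0.
  apply: leq_trans (leq_card_setU _ _) _; apply: leq_add le.
  by apply: leq_trans (leq_imset_card _ _) _; apply: sel_card => //; apply: hT.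
rewrite big_split /= sum1_card leq_add2l -sum1_card.
rewrite [X in _ <= X]big_mkcond [X in X <= _]big_mkcond /=; apply: leq_sum => v _.
by rewrite inE; case: (bow _ _ _); case: ifP.
Qed.

Lemma edge_eq v w x y : edge v w = edge x y -> (x = v /\ y = w) \/ (x = w /\ y = v).
Proof.
move=> e; have : x \in edge v w by rewrite e !inE eqxx.
rewrite !inE => /orP[]/eqP xe; [left | right]; split=> //; subst x.
  by apply: (@edge_inj v).
by apply: (@edge_inj w); rewrite -e edgeC.
Qed.

(** If [u] and [w] are not adjacent, [v] is a center, and its link or its selected edges contain one
    of the two edges. If only [u w] had been deleted, the triangle [u v w] would have lost a single
    edge: a link is excluded by [linked_no_triangle], a selected edge by [sel_triangle]. *)
Lemma no_bicolored r b (E2 : {set {set 'I_n}}) (T : {set 'I_n}) u v w : mono_free r b ->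
  (forall e, e \in E2 -> exists x y, linked r b x y /\ e = edge x y) ->
  (forall x, x \in T -> center r b x) ->
  (forall x, center r b x -> x \notin T ->
     exists2 y, linked r b x y & edge x y \in E2) ->
  u != w -> r u v -> b v w -> edge u v \notin deletion r b E2 T ->
  edge v w \notin deletion r b E2 T ->
  adj r b u w && (edge u w \notin deletion r b E2 T).
Proof.
move=> H hE hT hC uw uv vw nuv nvw.
have D2 e : e \in E2 -> e \in deletion r b E2 T by move=> h; rewrite inE h.
have DT x z : x \in T -> z \in sel r b x -> edge x z \in deletion r b E2 T.
  move=> xT hz; rewrite inE; apply/orP; right; apply/bigcupP; exists x => //.
  exact: imset_f.
have vu : r v u by rewrite (mf_rsym H).
apply/andP; split.
  apply/negPn/negP=> nadj; have h : cpair r b v u w by rewrite /cpair vu vw.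
  have cv : center r b v by apply/centerP; exists u, w.
  case vT: (v \in T).
    case/orP: (sel_cover H h) => /(DT _ _ vT).
      by rewrite edgeC (negbTE nuv).
    by rewrite (negbTE nvw).
  have [y l ey] := hC _ cv (negbT vT).
  case/and3P: l => _ _ /orP[]/loneP[_ L].
    by move: nuv; rewrite edgeC (L _ vu) D2.
  by move: nvw; rewrite (L _ vw) D2.
have auv : adj r b u v by rewrite /adj uv.
have awv : adj r b w v by rewrite /adj (mf_bsym H w) vw orbT.
apply/negP; rewrite inE => /orP[/hE[x [y [l e]]]|/bigcupP[x xT /imsetP[y hy e]]].
  have nt := linked_no_triangle H l (z := v).
  have [[? ?]|[? ?]] := edge_eq e; subst; exact: nt.
have aux p q : p \in T -> q \in sel r b p -> adj r b p v -> adj r b q v ->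
    edge p v \in deletion r b E2 T \/ edge q v \in deletion r b E2 T.
  move=> pT qs pv qv.
  have [h|[cv qv' nl]] := sel_triangle H (hT _ pT) qs pv qv; first by left; apply: DT.
  right; rewrite edgeC; apply: DT => //; apply/negPn/negP=> vT.
  by have [z l _] := hC _ cv vT; move: (nl z); rewrite l.
have [[ex ey]|[ex ey]] := edge_eq e; subst x y.
  by have [] := aux _ _ xT hy auv awv; rewrite ?(negbTE nuv) // edgeC (negbTE nvw).
by have [] := aux _ _ xT hy awv auv; rewrite ?(negbTE nuv) // edgeC (negbTE nvw).
Qed.

End LocalStructure.

(** * Peeling alternating paths *)

Section Peeling.
Variable n : nat.
Implicit Types (v w x y : 'I_n) (A I W T C : {set 'I_n}).

(* Vertices are numbered from 1; the number 0 stands for "no vertex". *)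
Definition onat (o : option 'I_n) : nat := if o is Some v then v.+1 else 0.
Definition vert (p : nat) : option 'I_n := if p is q.+1 then insub q else None.

Lemma vertS v : vert v.+1 = Some v.
Proof. by rewrite /= valK. Qed.

Lemma vert_onat p v : vert p = Some v -> p = v.+1.
Proof. by case: p => //= q; case: insubP => // u _ <- [->]. Qed.

Record pstate := PState { alive : {set 'I_n}; cur : nat; scan : nat; singles : nat }.

Definition partner A (f : 'I_n -> option 'I_n) v : option 'I_n :=
  if f v is Some w then if w \in A then Some w else None else None.

Definition rescan s := PState (alive s) (scan s) (scan s).+1 (singles s).

(** One of [f w] and [g w] is the removed [v], so the sum of both numbers minus that of [v] is the
    other neighbour of [w], or 0. It is the only vertex that may have become an end, so it is
    treated next. Each step removes a vertex or advances the scan. *)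
Definition peel_step (f g : 'I_n -> option 'I_n) (s : pstate) : pstate :=
  if vert (cur s) is Some v then
    if v \in alive s then
      match partner (alive s) f v, partner (alive s) g v with
      | None, None => PState (alive s :\ v) 0 (scan s) (singles s).+1
      | Some w, None | None, Some w =>
          PState (alive s :\ v :\ w) (onat (f w) + onat (g w) - v.+1) (scan s) (singles s)
      | Some _, Some _ => rescan s
      end
    else rescan s
  else rescan s.

Variables (C : {set 'I_n}) (f g : 'I_n -> option 'I_n).
Hypothesis f_sym : forall v w, v \in C -> f v = Some w -> f w = Some v.
Hypothesis g_sym : forall v w, v \in C -> g v = Some w -> g w = Some v.
Hypothesis f_irr : forall v, f v <> Some v.
Hypothesis g_irr : forall v, g v <> Some v.

Definition link v w := [&& v \in C, w \in C & (f v == Some w) || (g v == Some w)].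

Lemma link_sym v w : link v w -> link w v.
Proof.
case/and3P=> vC wC /orP[]/eqP h; rewrite /link vC wC.
  by rewrite (f_sym vC h) eqxx.
by rewrite (g_sym vC h) eqxx orbT.
Qed.

Definition full A v :=
  (exists2 w, w \in A & f v = Some w) /\ (exists2 w, w \in A & g v = Some w).

(* [W] holds the neighbours removed along with a current vertex, and [T] the
   vertices that were removed alone.  Vertices outside [A] and [W] are those at
   which a removal started; they are independent. *)
Definition peel_inv A t W T (E : {set {set 'I_n}}) : Prop :=
  [/\ A \subset C, W \subset C, [disjoint A & W], T \subset C :\: (A :|: W) & #|T| = t] /\
  [/\ #|C| = #|A| + t + 2 * #|W|,
      forall v w, v \in C -> v \notin A -> v \notin W -> link v w -> w \in W,
      forall e, e \in E -> exists v w, link v w /\ e = edge v w,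
      #|E| <= #|W| &
      forall v, v \in C -> v \notin A -> v \notin T -> exists2 w, link v w & edge v w \in E].

Definition scan_inv A c s := forall v, v \in A -> v.+1 < s -> v.+1 != c -> full A v.

(** Only a neighbour of a removed vertex can cease to be full; the second hypothesis makes it the
    new current vertex, which [scan_inv] exempts. *)
Lemma scan_inv_sub A A' c c' s : A' \subset A ->
  (forall v w, v \in A' -> link v w -> w \in A -> w \notin A' -> v.+1 = c') ->
  (forall v, v \in A' -> v.+1 != c) -> A \subset C ->
  scan_inv A c s -> scan_inv A' c' s.
Proof.
move=> /subsetP sub hl hc /subsetP AC hs v vA lt vc.
have [[w wA fw] [x xA gx]] := hs v (sub _ vA) lt (hc _ vA).
have vC := AC _ (sub _ vA).
split; [exists w => // | exists x => //]; apply/negPn/negP=> h; case/eqP: vc.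
  by apply: (hl v w) => //; rewrite /link vC AC // fw eqxx.
by apply: (hl v x) => //; rewrite /link vC AC // gx eqxx orbT.
Qed.

Lemma peel_single A t W T E v : v \in A -> (forall w, w \in A -> ~~ link v w) ->
  peel_inv A t W T E -> peel_inv (A :\ v) t.+1 W (v |: T) E.
Proof.
move=> vA nl [[AC WC AW TA tT] [cC hI hE cE hC]].
have eA : #|A| = #|A :\ v|.+1 by rewrite (cardsD1 v) vA.
have vC := subsetP AC _ vA.
have vW : v \notin W by rewrite (disjointFr AW).
have vT : v \notin T by apply/negP => /(subsetP TA); rewrite !inE vA.
split; split=> //.
- exact: subset_trans (subD1set _ _) AC.
- by apply: disjointWl AW; apply: subD1set.
- apply/subsetP=> x; rewrite !inE => /orP[/eqP->|/(subsetP TA)].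
    by rewrite eqxx (negbTE vW) vC.
  by rewrite !inE negb_or => /andP[/andP[/negbTE-> /negbTE->] ->]; rewrite andbF.
- by rewrite cardsU1 vT tT.
- by rewrite cC eA addSn addnS.
- move=> x w xC; rewrite !inE negb_and negbK; case: eqP => [-> _ _ l|_ /= xA xW l].
    have /and3P[_ wC _] := l; apply/negPn/negP=> wW.
    case wA: (w \in A); first by have := nl _ wA; rewrite l.
    (* Such a [w] would be an earlier start, whose neighbours all lie in [W], while [v] does not. *)
    by have := hI _ _ wC (negbT wA) wW (link_sym l); rewrite (negbTE vW).
  exact: hI l.
- move=> x xC; rewrite !inE negb_and negbK negb_or => /orP[->//|xA] /andP[_ xT].
  exact: hC.
Qed.

Lemma peel_pair A t W T E v w : v \in A -> w \in A -> link v w ->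
  (forall x, x \in A -> link v x -> x = w) -> v != w ->
  peel_inv A t W T E -> peel_inv (A :\ v :\ w) t (w |: W) T (edge v w |: E).
Proof.
move=> vA wA lvw nl vw [[AC WC AW TA tT] [cC hI hE cE hC]].
have eA : #|A| = #|A :\ v :\ w|.+2.
  by rewrite (cardsD1 v) vA (cardsD1 w (A :\ v)) !inE eq_sym vw wA.
have vC := subsetP AC _ vA; have wC := subsetP AC _ wA.
have vW : v \notin W by rewrite (disjointFr AW).
have wW : w \notin W by rewrite (disjointFr AW).
have sub : A :\ v :\ w \subset A by apply: subset_trans (subD1set _ _) (subD1set _ _).
split; split=> //.
- exact: subset_trans sub AC.
- by apply/subsetP=> x; rewrite !inE => /orP[/eqP->//|]; apply: (subsetP WC).
- rewrite disjoints_subset; apply/subsetP=> x; rewrite !inE => /and3P[xw xv xA].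
  by rewrite negb_or xw (disjointFr AW).
- apply: subset_trans TA _; apply: setDS; apply/subsetP=> x; rewrite !inE.
  by case: eqP => [->|_] /=; rewrite ?wA //; case: (x \in A); rewrite ?andbF.
- have aux (a m q u : nat) : q = m.+1 -> a.+2 + u + 2 * m = a + u + 2 * q.
    by clear; lia.
  by rewrite cC eA; apply: aux; rewrite cardsU1 wW.
- move=> x y xC; rewrite !inE !negb_and !negbK negb_or => xA /andP[xw xW] l.
  have /and3P[_ yC _] := l; have [//|yw] := eqVneq y w.
  rewrite (negbTE xw) /= in xA; case/orP: xA => [/eqP e|xA]; last exact: hI l.
  rewrite e in l; apply/negPn/negP=> yW.
  case yA: (y \in A); first by move: yw; rewrite (nl _ yA l) eqxx.
  by have := hI _ _ yC (negbT yA) yW (link_sym l); rewrite (negbTE vW).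
- by move=> e; rewrite !inE => /orP[/eqP->|/hE //]; exists v, w.
- by rewrite cardsU1 [#|w |: W|]cardsU1 wW; apply: leq_add cE; case: (_ \notin _).
- move=> x xC; rewrite !inE !negb_and !negbK => /or3P[/eqP->|/eqP->|xA] xT.
  + by exists v; [apply: link_sym | rewrite edgeC !inE eqxx].
  + by exists w; rewrite // !inE eqxx.
  + by have [y l ey] := hC _ xC xA xT; exists y; rewrite // !inE ey orbT.
Qed.

(** The third clause bounds time by progress: after [2 * n + 1] steps, [#|C| <= n] forces the scan
    to at least [n + 2]. By the last clause the current number is then beyond all vertices, so the
    exemption in [scan_inv] is void and every vertex still alive is full. *)
Definition step_inv k s : Prop :=
  [/\ exists W T E, peel_inv (alive s) (singles s) W T E,
      scan_inv (alive s) (cur s) (scan s),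
      k + #|alive s| + 1 <= scan s + #|C| & n.+2 <= scan s -> n.+1 <= cur s].

Lemma rescan_inv k s :
  (forall v, v \in alive s -> cur s = v.+1 -> full (alive s) v) ->
  step_inv k s -> step_inv k.+1 (rescan s).
Proof.
move=> hc [hp hs hk hn]; split=> //=.
move=> v vA; rewrite ltnS leq_eqVlt => /orP[->//|lt _].
by have [e|ne] := eqVneq v.+1 (cur s); [apply: hc | apply: hs].
Qed.

Lemma partnerP A h v w : partner A h v = Some w <-> h v = Some w /\ w \in A.
Proof.
rewrite /partner; case: (h v) => [x|]; last by split=> // -[].
case: ifP => xA; split=> //; first by case=> <-.
  by case=> [[->]].
by case=> [[<-]]; rewrite xA.
Qed.

Lemma partner_None A h v w : partner A h v = None -> w \in A -> h v <> Some w.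
Proof. by rewrite /partner => + wA e; rewrite e wA. Qed.

Lemma peel_pair_step k s v w : cur s = v.+1 -> v \in alive s -> w \in alive s ->
  link v w -> (forall x, x \in alive s -> link v x -> x = w) ->
  step_inv k s ->
  step_inv k.+1 (PState (alive s :\ v :\ w) (onat (f w) + onat (g w) - v.+1) (scan s) (singles s)).
Proof.
move=> ec vA wA l nl [[W [T [E hp]]] hs hk hn].
have vw : v != w.
  apply/eqP=> e; rewrite -e in l; case/and3P: l => _ _ /orP[]/eqP; [exact: f_irr|exact: g_irr].
have AC : alive s \subset C by case: hp => [[]].
split=> /=.
- by exists (w |: W), T, (edge v w |: E); apply: peel_pair.
- apply: (scan_inv_sub _ _ _ AC hs).
  + by apply: subset_trans (subD1set _ _) (subD1set _ _).
  + move=> x y; rewrite !inE !negb_and !negbK => /and3P[xw xv xA] lxy yA.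
    case/or3P=> [/eqP e|/eqP e|]; last by rewrite yA.
      (* Here [x] and [v] are the two neighbours of [w], one along [f] and one along [g]. *)
      rewrite e in lxy; have lx := link_sym lxy; have lv := link_sym l.
      case/and3P: lx => _ _ /orP[]/eqP ex; case/and3P: lv => _ _ /orP[]/eqP ev; rewrite ?ex ?ev /=.
      - by move: ex; rewrite ev => -[e2]; rewrite e2 eqxx in xv.
      - by rewrite addnK.
      - by rewrite addnC addnK.
      - by move: ex; rewrite ev => -[e2]; rewrite e2 eqxx in xv.
    by rewrite e in lxy; move: xw; rewrite (nl _ xA (link_sym lxy)) eqxx.
  + move=> x; rewrite !inE ec => /and3P[_ xv _].
    by apply: contraNneq xv => -[] /ord_inj->.
- have : #|alive s| = #|alive s :\ v :\ w|.+2.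
    by rewrite (cardsD1 v) vA (cardsD1 w (_ :\ v)) !inE eq_sym vw wA.
  have aux a q m : k + a + 1 <= m -> a = q.+2 -> k.+1 + q + 1 <= m by lia.
  exact: aux hk.
- by move=> /hn; rewrite ec ltnS => h; have := ltn_ord v; lia.
Qed.

Lemma peel_step_inv k s : step_inv k s -> step_inv k.+1 (peel_step f g s).
Proof.
move=> hs; have AC : alive s \subset C by case: hs => -[W [T [E [[]]]]].
rewrite /peel_step; case ev: (vert (cur s)) => [v|]; last first.
  by apply: rescan_inv => // v vA e; move: ev; rewrite e vertS.
have ec := vert_onat ev.
case vA: (v \in alive s); last first.
  apply: rescan_inv => // x xA; rewrite ec => -[e].
  by rewrite (ord_inj e) xA in vA.
have vC := subsetP AC _ vA.
have lf w : w \in alive s -> f v = Some w -> link v w.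
  by move=> wA e; rewrite /link vC (subsetP AC) // e eqxx.
have lg w : w \in alive s -> g v = Some w -> link v w.
  by move=> wA e; rewrite /link vC (subsetP AC) // e eqxx orbT.
case ep: (partner (alive s) f v) => [w|]; case eq: (partner (alive s) g v) => [w'|].
- apply: rescan_inv => // x xA; rewrite ec => -[/ord_inj<-].
  by move/partnerP: ep => [h1 h2]; move/partnerP: eq => [h3 h4]; split; [exists w|exists w'].
- have [e wA] := (partnerP _ _ _ _).1 ep.
  apply: peel_pair_step => //; first exact: lf.
  move=> x xA /and3P[_ _ /orP[]/eqP]; first by rewrite e => -[].
  by move/(partner_None eq xA).
- have [e wA] := (partnerP _ _ _ _).1 eq.
  apply: peel_pair_step => //; first exact: lg.
  move=> x xA /and3P[_ _ /orP[]/eqP]; last by rewrite e => -[].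
  by move/(partner_None ep xA).
- have nl w : w \in alive s -> ~~ link v w.
    move=> wA; apply/negP => /and3P[_ _ /orP[]/eqP]; [exact: partner_None ep wA|exact: partner_None eq wA].
  case: hs => [[W [T [E hp]]] hs hk hn]; split=> /=.
  + by exists W, (v |: T), E; apply: peel_single.
  + apply: (scan_inv_sub _ _ _ AC hs); first exact: subD1set.
      move=> x w; rewrite !inE negb_and negbK => /andP[xv xA] l wA.
      case/orP=> [/eqP e|]; last by rewrite wA.
      by rewrite e in l; have := nl _ xA; rewrite link_sym.
    move=> x; rewrite !inE ec => /andP[xv _].
    by apply: contraNneq xv => -[] /ord_inj->.
  + have aux a q m : k + a + 1 <= m -> a = true + q -> k.+1 + q + 1 <= m by lia.
    by apply: aux hk _; rewrite (cardsD1 v) vA.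
  + by move=> /hn; rewrite ec ltnS => h; have := ltn_ord v; lia.
Qed.

Definition peel_run := iter (2 * n).+1 (peel_step f g) (PState C 0 1 0).

Lemma peel_run_inv : exists W T E, peel_inv (alive peel_run) (singles peel_run) W T E /\
  forall v, v \in alive peel_run -> full (alive peel_run) v.
Proof.
have init : step_inv 0 (PState C 0 1 0).
  split=> //=; last by rewrite addnC.
  exists set0, set0, set0; split; split; rewrite ?sub0set ?cards0 ?disjoints_subset ?setC0 ?subsetT //.
  + by rewrite muln0 !addn0.
  + by move=> v w ->.
  + by move=> e; rewrite inE.
  + by move=> v ->.
have h : step_inv (2 * n).+1 peel_run.
  by rewrite /peel_run; elim: (_.+1) => // k IH; apply: peel_step_inv.
case: h => [[W [T [E hp]]] hs hk hn]; exists W, T, E; split=> // v vA.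
have cn : #|C| <= n by rewrite -[n in _ <= n]card_ord max_card.
have sn : n.+2 <= scan peel_run by lia.
have lt := ltn_ord v; have := hn sn => hc.
by apply: hs => //; lia.
Qed.

(* The vertices left over lie on cycles alternating between [f] and [g]: there the
   weight 1 is optimal, and the [f]-edges form a perfect matching. *)
Lemma peel_run_correct : exists (y : 'I_n -> nat) (T : {set 'I_n}) (E : {set {set 'I_n}}),
  [/\ forall v, y v <= 2, forall v w, link v w -> y v + y w <= 2,
      forall v, v \in C -> (forall w, ~~ link v w) -> y v = 2 &
      \sum_(v in C) y v = #|C| + singles peel_run] /\
  [/\ T \subset C, forall e, e \in E -> exists v w, link v w /\ e = edge v w,
      forall v, v \in C -> v \notin T -> exists2 w, link v w & edge v w \in E &
      2 * (#|E| + #|T|) <= #|C| + singles peel_run].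
Proof.
have [W [T [E [hp hf]]]] := peel_run_inv; set A := alive _ in hp hf.
case: hp => [[AC WC AW TA tT] [cC hI hE cE hC]].
have AWF v : v \in A -> v \in W = false by move=> vA; rewrite (disjointFr AW).
(* Weight 1 on the remaining cycles, 0 on the neighbours removed along, 2 on the independent
   starts. *)
pose y v := if v \in A then 1 else if v \in W then 0 else 2.
pose phi v := odflt v (f v).
have phiA v : v \in A -> [/\ phi v \in A, f v = Some (phi v), phi (phi v) = v & phi v != v].
  move=> vA; have [[w wA e] _] := hf _ vA; rewrite /phi e /=.
  rewrite (f_sym (subsetP AC _ vA) e); split=> //.
  by apply/eqP=> e2; apply: (@f_irr v); rewrite e e2.
have phil v : v \in A -> link v (phi v).
  by move=> vA; have [h e _ _] := phiA v vA; rewrite /link !(subsetP AC) // e eqxx.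
(* Each matching edge is counted from its smaller end; [phi] injects [A1] into [A2], so there are at
   most [#|A| / 2] of them. *)
pose A1 := [set v in A | v < phi v]; pose A2 := [set v in A | phi v < v].
have cA : #|A1| + #|A2| = #|A|.
  rewrite -(cardsID [set v : 'I_n | v < phi v] A); congr (_ + _); apply: eq_card => v.
    by rewrite !inE.
  rewrite !inE -leqNgt andbC; case vA: (v \in A); rewrite ?andbF //= andbT.
  have [_ _ _ ne] := phiA v vA; by rewrite ltn_neqAle (inj_eq (@ord_inj n)) ne andbT.
have c12 : #|A1| <= #|A2|.
  rewrite -(card_in_imset (f := phi) (D := A1)).
    apply: subset_leq_card; apply/subsetP => x /imsetP[v]; rewrite inE => /andP[vA lt] ->.
    by have [h1 _ h2 _] := phiA v vA; rewrite inE h1 h2.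
  move=> v w; rewrite !inE => /andP[vA _] /andP[wA _] e.
  by have [_ _ <- _] := phiA v vA; rewrite e; have [_ _ -> _] := phiA w wA.
exists y, T, (E :|: [set edge v (phi v) | v in A1]); split; split.
- by move=> v; rewrite /y; do 2 case: ifP => //.
- move=> v w l; have /and3P[vC wC _] := l.
  rewrite /y; case vA: (v \in A).
    case wA: (w \in A) => //; case: ifP => // wW.
    by have := hI _ _ wC (negbT wA) (negbT wW) (link_sym l); rewrite AWF.
  case: ifP => vW; first by case: ifP => // _; case: ifP.
  by have wW := hI _ _ vC (negbT vA) (negbT vW) l; rewrite wW; case: ifP => // /AWF; rewrite wW.
- move=> v vC nl; rewrite /y; case: ifP => [vA|vA]; first by have := nl (phi v); rewrite phil.
  case: ifP => // vW; have vT : v \notin T.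
    by apply/negP=> vT; move/subsetP: TA => /(_ _ vT); rewrite !inE vW orbT.
  by have [w l _] := hC _ vC (negbT vA) vT; have := nl w; rewrite l.
- rewrite (big_setID A) /= (setIidPr AC).
  rewrite (eq_bigr (fun=> 1)) ?sum1_card; last by move=> v vA; rewrite /y vA.
  rewrite (big_setID W) /= big1 ?add0n => [|v]; last first.
    by rewrite !inE /y => /andP[/andP[/negbTE-> _] ->].
  rewrite (eq_bigr (fun=> 2)) ?sum_nat_const; last first.
    by move=> v; rewrite !inE /y => /and3P[/negbTE-> /negbTE-> _].
  have : #|C :\: A| = #|W| + #|C :\: A :\: W|.
    rewrite -(cardsID W (C :\: A)); congr (_ + _); apply: eq_card=> v; rewrite !inE.
    case vW: (v \in W); rewrite ?andbF // andbT (subsetP WC) // andbT.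
    by apply/negP=> /AWF; rewrite vW.
  have aux (a w cw cd c t : nat) : c = a + t + 2 * w -> a + cd = c -> cd = w + cw ->
    a + cw * 2 = c + t by lia.
  by move=> h; apply: aux cC _ h; rewrite -(cardsID A C) (setIidPr AC).
- by apply: subset_trans TA _; apply: subsetDl.
- move=> e; rewrite inE => /orP[/hE //|/imsetP[v]]; rewrite inE => /andP[vA _] ->.
  by exists v, (phi v); split=> //; apply: phil.
- move=> v vC vT; case vA: (v \in A); last first.
    by have [w l ew] := hC _ vC (negbT vA) vT; exists w; rewrite // inE ew.
  exists (phi v); first exact: phil.
  have [h1 _ h2 ne] := phiA v vA; rewrite inE; apply/orP; right.
  case: (ltngtP v (phi v)) => lt; last by move: ne; rewrite -(ord_inj lt) eqxx.
    by apply/imsetP; exists v; rewrite // inE vA.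
  by apply/imsetP; exists (phi v); rewrite ?h2 1?edgeC // inE h1 h2.
- have aux (eu e im a1 a2 a m t c : nat) : e <= m -> a1 <= a2 -> a1 + a2 = a ->
    c = a + t + 2 * m -> eu <= e + im -> im <= a1 -> 2 * (eu + t) <= c + t by lia.
  rewrite tT; apply: aux cE c12 cA cC (leq_card_setU _ _) _.
  exact: (leq_imset_card (fun v => edge v (phi v)) A1).
Qed.

End Peeling.

(** * Compiling loop-free commands to the RAM *)

(** Quantifying over the remaining fuel [T] makes runs compose by adding their times. *)
Definition reach (P : seq instr) (t : nat) (c c' : config) : Prop :=
  forall T, exec P (t + T) c = exec P T c'.

Lemma reach_refl P c : reach P 0 c c.
Proof. by move=> T. Qed.

Lemma reach_refl_eq P pc pc' m : pc = pc' -> reach P 0 (Cfg pc m) (Cfg pc' m).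
Proof. by move=> -> T. Qed.

Lemma reach_trans P t1 t2 c1 c2 c3 :
  reach P t1 c1 c2 -> reach P t2 c2 c3 -> reach P (t1 + t2) c1 c3.
Proof. by move=> h1 h2 T; rewrite -addnA h1 h2. Qed.

Lemma reach_step P t c c1 c2 :
  step P c = Some c1 -> reach P t c1 c2 -> reach P t.+1 c c2.
Proof. by move=> h1 h2 T; rewrite addSn /= h1 h2. Qed.

Lemma exec_halt P t T c c' :
  reach P t c c' -> step P c' = None -> t <= T -> exec P T c = Some c'.
Proof.
by move=> h hN le; rewrite -(subnKC le) h; case: (T - t) => [|u] /=; rewrite hN.
Qed.

Definition code_at (P : seq instr) (pc : nat) (code : seq instr) : Prop :=
  exists pre post, P = pre ++ code ++ post /\ size pre = pc.

Lemma code_at_cat P pc c1 c2 :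
  code_at P pc (c1 ++ c2) -> code_at P pc c1 /\ code_at P (pc + size c1) c2.
Proof.
case=> pre [post [-> <-]]; split.
  by exists pre, (c2 ++ post); rewrite -!catA.
by exists (pre ++ c1), post; rewrite size_cat -!catA.
Qed.

Lemma code_at_cons P pc i c :
  code_at P pc (i :: c) -> nth IHalt P pc = i /\ code_at P pc.+1 c.
Proof.
rewrite -cat1s => h; have [[pre [post [-> <-]]] h2] := code_at_cat h.
by rewrite addn1 in h2; split=> //; rewrite nth_cat ltnn subnn.
Qed.

(** * A loop-free language and its compilation *)

Inductive exp := EVar of nat | ECst of nat | EAdd of exp & exp
  | ESub of exp & exp | ELd of exp & nat.

Inductive cmd := CSkip | CAsg of nat & exp | CSto of exp & nat & exp
  | CSeq of cmd & cmd | CIf of exp & cmd & cmd.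

Record state := State { reg : nat -> nat; heap : nat -> nat -> nat }.

Fixpoint eval (e : exp) (s : state) : nat :=
  match e with
  | EVar r => reg s r
  | ECst v => v
  | EAdd a b => eval a s + eval b s
  | ESub a b => eval a s - eval b s
  | ELd a f => heap s (eval a s) f
  end.

Definition hupd (h : nat -> nat -> nat) p f v : nat -> nat -> nat :=
  fun q g => if (q == p) && (g == f) then v else h q g.

Fixpoint ev (c : cmd) (s : state) : state :=
  match c with
  | CSkip => s
  | CAsg r e => State (upd (reg s) r (eval e s)) (heap s)
  | CSto a f e => State (reg s) (hupd (heap s) (eval a s) f (eval e s))
  | CSeq c1 c2 => ev c2 (ev c1 s)
  | CIf e c1 c2 => if eval e s == 0 then ev c2 s else ev c1 s
  end.

(* Register 2 holds the heap base [B]; field [f] of record [p] lives at address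
   [B + 8 * p + f].  Variables are the registers below 32, and the registers
   from 32 on serve as the evaluation stack. *)
Definition represents (B : nat) (m : nat -> nat) (s : state) : Prop :=
  [/\ m 2 = B, forall r, r < 32 -> m r = reg s r &
      forall p f, f < 8 -> m (B + 8 * p + f) = heap s p f].

Fixpoint compile_exp (e : exp) (t : nat) : seq instr :=
  match e with
  | EVar r => [:: IConst t 0; IAdd t r t]
  | ECst v => [:: IConst t v]
  | EAdd a b => compile_exp a t ++ compile_exp b t.+1 ++ [:: IAdd t t t.+1]
  | ESub a b => compile_exp a t ++ compile_exp b t.+1 ++ [:: ISub t t t.+1]
  | ELd a f => compile_exp a t ++
      [:: IAdd t t t; IAdd t t t; IAdd t t t; IAdd t t 2;
          IConst t.+1 f; IAdd t t t.+1; ILoad t t]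
  end.

(** A load at stack position [t] uses [t.+1] as scratch, so cell 63 is the last one touched; a heap
    base of at least 64 keeps stack and heap apart. *)
Fixpoint wf_exp (e : exp) (t : nat) : bool :=
  match e with
  | EVar r => (r < 32) && (t < 63)
  | ECst _ => t < 63
  | EAdd a b | ESub a b => wf_exp a t && wf_exp b t.+1
  | ELd a f => wf_exp a t && (f < 8)
  end.

Lemma wf_exp_lt e t : wf_exp e t -> t < 63.
Proof.
by elim: e t => //= [r|a IHa b _|a IHa b _|a IHa f] t /andP[] // /IHa.
Qed.

Lemma updE m r v i : upd m r v i = if i == r then v else m i.
Proof. by []. Qed.

Lemma upd_same m r v : upd m r v r = v.
Proof. by rewrite updE eqxx. Qed.

Lemma upd_neq m r v i : i != r -> upd m r v i = m i.
Proof. by rewrite updE => /negbTE->. Qed.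

Lemma represents_frame B m m' s t : 64 <= B -> 32 <= t ->
  represents B m s -> (forall i, ~~ (t <= i < 64) -> m' i = m i) ->
  represents B m' s.
Proof.
move=> hB ht [h2 hr hh] hm; split; first by rewrite hm ?h2 //; lia.
  by move=> r hlt; rewrite hm ?hr //; lia.
by move=> p f hf; rewrite hm ?hh //; lia.
Qed.

Lemma compile_expP P B e t pc m s : 64 <= B -> 32 <= t -> wf_exp e t ->
  represents B m s -> code_at P pc (compile_exp e t) ->
  exists m', [/\ reach P (size (compile_exp e t)) (Cfg pc m)
                   (Cfg (pc + size (compile_exp e t)) m'),
    m' t = eval e s & forall i, ~~ (t <= i < 64) -> m' i = m i].
Proof.
move=> hB; elim: e t pc m => [r|v|a IHa b IHb|a IHa b IHb|a IHa f] t pc m ht.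
- move=> /= /andP[hr ht'] [_ hreg _] /code_at_cons[i1 /code_at_cons[i2 _]].
  exists (upd (upd m t 0) t (upd m t 0 r + upd m t 0 t)); split.
  + apply: reach_step; first by rewrite /step i1.
    apply: reach_step; first by rewrite /step i2.
    by rewrite addn2; apply: reach_refl.
  + by rewrite !upd_same addn0 upd_neq ?hreg //; lia.
  + by move=> i hi; rewrite !upd_neq //; lia.
- move=> /= ht' _ /code_at_cons[i1 _].
  exists (upd m t v); split; last by move=> i hi; rewrite upd_neq //; lia.
    apply: reach_step; first by rewrite /step i1.
    by rewrite addn1; apply: reach_refl.
  by rewrite upd_same.
- rewrite /= => /andP[wa wb] hm /code_at_cat[ca /code_at_cat[cb /code_at_cons[i1 _]]].
  have [m1 [r1 v1 f1]] := IHa t pc m ht wa hm ca.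
  have hm1 := represents_frame hB ht hm f1.
  have [m2 [r2 v2 f2]] := IHb t.+1 _ m1 (leqW ht) wb hm1 cb.
  have := wf_exp_lt wb => lt.
  exists (upd m2 t (m2 t + m2 t.+1)); split.
  + rewrite !size_cat addnA; apply: reach_trans.
      exact: reach_trans r1 r2.
    apply: reach_step; first by rewrite /step i1.
    by apply: reach_refl_eq; rewrite /=; lia.
  + by rewrite upd_same v2 f2 ?v1 //; lia.
  + by move=> i hi; rewrite upd_neq ?f2 ?f1 //; lia.
- rewrite /= => /andP[wa wb] hm /code_at_cat[ca /code_at_cat[cb /code_at_cons[i1 _]]].
  have [m1 [r1 v1 f1]] := IHa t pc m ht wa hm ca.
  have hm1 := represents_frame hB ht hm f1.
  have [m2 [r2 v2 f2]] := IHb t.+1 _ m1 (leqW ht) wb hm1 cb.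
  have := wf_exp_lt wb => lt.
  exists (upd m2 t (m2 t - m2 t.+1)); split.
  + rewrite !size_cat addnA; apply: reach_trans.
      exact: reach_trans r1 r2.
    apply: reach_step; first by rewrite /step i1.
    by apply: reach_refl_eq; rewrite /=; lia.
  + by rewrite upd_same v2 f2 ?v1 //; lia.
  + by move=> i hi; rewrite upd_neq ?f2 ?f1 //; lia.
- rewrite /= => /andP[wa hf] hm /code_at_cat[ca].
  do 7![case/code_at_cons => ?]; move=> _.
  have [m1 [r1 v1 f1]] := IHa t pc m ht wa hm ca.
  have [hm2 _ hm3] := represents_frame hB ht hm f1.
  have lt := wf_exp_lt wa.
  pose x := eval a s.
  have tt : t != t.+1 by lia.
  have t2 : 2 != t by lia.
  have t3 : t.+1 != t by lia.
  eexists; split.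
  + rewrite size_cat; apply: reach_trans; first exact: r1.
    rewrite /=.
    do 7![apply: reach_step; first by rewrite /step; match goal with H : nth _ _ ?k = _ |- context[nth IHalt P ?k] => rewrite H; reflexivity end].
    by apply: reach_refl_eq; lia.
  + rewrite upd_same. rewrite !(upd_same, upd_neq _ _ tt, upd_neq _ _ t2, upd_neq _ _ t3) v1 hm2.
    rewrite -/x upd_neq ?upd_neq ?upd_neq ?upd_neq ?upd_neq ?upd_neq; try lia.
    by rewrite -(hm3 _ _ hf); congr (m1 _); lia.
  + by move=> i hi; rewrite !upd_neq ?f1 //; lia.
Qed.

(** Jump targets are absolute, so the code depends on its position [pc]. *)
Fixpoint compile_cmd (c : cmd) (pc : nat) : seq instr :=
  match c with
  | CSkip => [::]
  | CAsg r e => compile_exp e 32 ++ [:: IConst r 0; IAdd r r 32]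
  | CSto a f e => compile_exp a 32 ++ compile_exp e 33 ++
      [:: IAdd 32 32 32; IAdd 32 32 32; IAdd 32 32 32; IAdd 32 32 2;
          IConst 34 f; IAdd 32 32 34; IStore 32 33]
  | CSeq c1 c2 =>
      let k1 := compile_cmd c1 pc in k1 ++ compile_cmd c2 (pc + size k1)
  | CIf e c1 c2 =>
      let k := compile_exp e 32 in
      let p1 := (pc + size k).+1 in
      let k1 := compile_cmd c1 p1 in
      let p2 := (p1 + size k1).+1 in
      let k2 := compile_cmd c2 p2 in
      k ++ [:: IJz 32 p2] ++ k1 ++ [:: IJmp (p2 + size k2)] ++ k2
  end.

Definition wf_var (r : nat) : bool := (r < 32) && (r != 2).

Fixpoint wf_cmd (c : cmd) : bool :=
  match c with
  | CSkip => true
  | CAsg r e => wf_var r && wf_exp e 32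
  | CSto a f e => [&& wf_exp a 32, wf_exp e 33 & f < 8]
  | CSeq c1 c2 => wf_cmd c1 && wf_cmd c2
  | CIf e c1 c2 => [&& wf_exp e 32, wf_cmd c1 & wf_cmd c2]
  end.

(** The branches of a conditional differ in length, so only an upper bound on time is kept.
    Loop-free code runs each instruction at most once, which makes its size a bound. *)
Definition reach_le P t c c' : Prop := exists2 u, u <= t & reach P u c c'.

Lemma reach_le_trans P t1 t2 t c1 c2 c3 : t1 + t2 <= t ->
  reach_le P t1 c1 c2 -> reach_le P t2 c2 c3 -> reach_le P t c1 c3.
Proof.
move=> le [u1 le1 h1] [u2 le2 h2]; exists (u1 + u2); first by lia.
exact: reach_trans h1 h2.
Qed.

Lemma reach_le_refl P t c : reach_le P t c c.
Proof. by exists 0 => //; apply: reach_refl. Qed.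

Lemma reach_le_step P t c c1 c2 :
  step P c = Some c1 -> reach_le P t c1 c2 -> reach_le P t.+1 c c2.
Proof. by move=> h1 [u le h2]; exists u.+1 => //; apply: reach_step h1 h2. Qed.

Lemma reach_reach_le P t c c' : reach P t c c' -> reach_le P t c c'.
Proof. by exists t. Qed.

Ltac instr_step :=
  apply: reach_le_step;
  [ rewrite /step; match goal with H : nth _ _ ?k = _ |- context[nth IHalt _ ?k] =>
      rewrite H; reflexivity end | ].

Lemma compile_cmdP P B c pc m s : 64 <= B -> wf_cmd c ->
  represents B m s -> code_at P pc (compile_cmd c pc) ->
  exists2 m', reach_le P (size (compile_cmd c pc)) (Cfg pc m)
                (Cfg (pc + size (compile_cmd c pc)) m')
    & represents B m' (ev c s).
Proof.
move=> hB; elim: c pc m s => [|r e|a f e|c1 IH1 c2 IH2|e c1 IH1 c2 IH2] pc m s /=.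
- by move=> _ hm _; exists m => //; rewrite addn0; apply: reach_le_refl.
- move=> /andP[/andP[hr r2] we] hm /code_at_cat[ce].
  move=> /code_at_cons[i1 /code_at_cons[i2 _]].
  have [m1 [r1 v1 f1]] := compile_expP hB (leqnn 32) we hm ce.
  have [hm1 hm2 hm3] := represents_frame hB (leqnn 32) hm f1.
  eexists.
    rewrite size_cat; apply: reach_le_trans (reach_reach_le r1) _; first exact: leqnn.
    by do 2 instr_step; rewrite addnA addn2; apply: reach_le_refl.
  split => /=; first by rewrite !upd_neq //; lia.
    move=> q hq; case: (q =P r) => [->|/eqP hn].
      by rewrite !upd_same add0n upd_neq ?v1 //; lia.
    by rewrite !upd_neq ?hm2.
  by move=> p f hf; rewrite !upd_neq ?hm3 //; lia.
- move=> /and3P[wa we hf] hm /code_at_cat[ca /code_at_cat[ce]].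
  do 7![case/code_at_cons => ?]; move=> _.
  have [m1 [r1 v1 f1]] := compile_expP hB (leqnn 32) wa hm ca.
  have hm1 := represents_frame hB (leqnn 32) hm f1.
  have [m2 [r2 v2 f2]] := compile_expP hB (isT : 32 <= 33) we hm1 ce.
  have [hB2 hm2 hm3] := represents_frame hB (isT : 32 <= 33) hm1 f2.
  eexists.
    rewrite !size_cat; apply: reach_le_trans (reach_reach_le r1) _; first exact: leqnn.
    apply: reach_le_trans (reach_reach_le r2) _; first exact: leqnn.
    do 7 instr_step.
    by rewrite !addnA !addnS addn0; apply: reach_le_refl.
  have e32 : m2 32 = eval a s by rewrite f2 ?v1.
  match goal with |- represents _ (upd ?mm0 _ _) _ => set mm := mm0 end.
  have mm32 : mm 32 = B + 8 * eval a s + f by rewrite /mm /upd /= hB2 e32; lia.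
  have mm33 : mm 33 = eval e s by rewrite /mm /upd /= v2.
  have mmE i : i != 32 -> i != 34 -> mm i = m2 i by move=> ? ?; rewrite /mm !upd_neq.
  clearbody mm; rewrite mm32 mm33; split => /=.
  + by rewrite upd_neq ?mmE //; lia.
  + by move=> q hq; rewrite upd_neq ?mmE ?hm2 //; lia.
  + move=> p g hg; rewrite updE /hupd.
    case: (boolP ((p == _) && (g == f))) => [/andP[/eqP-> /eqP->]|hn].
      by rewrite eqxx.
    (* Both fields are below 8, so equal addresses mean the same record and the same field. *)
    case: eqP => [h|_]; first by case/negP: hn; lia.
    by rewrite mmE ?hm3 //; lia.
- move=> /andP[w1 w2] hm /code_at_cat[k1 k2].
  have [m1 r1 h1] := IH1 _ _ _ w1 hm k1.
  have [m2 r2 h2] := IH2 _ _ _ w2 h1 k2.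
  exists m2 => //; rewrite size_cat addnA.
  by apply: reach_le_trans r1 r2.
- move=> /and3P[we w1 w2] hm /code_at_cat[ke /code_at_cons[i1 /code_at_cat[k1 /code_at_cons[i2 k2]]]].
  have [m1 [r1 v1 f1]] := compile_expP hB (leqnn 32) we hm ke.
  have h1 := represents_frame hB (leqnn 32) hm f1.
  move: k1 k2 i1 i2.
  set k := compile_exp e 32; set p1 := (pc + size k).+1.
  set s1 := compile_cmd c1 p1; set p2 := (p1 + size s1).+1.
  set s2 := compile_cmd c2 p2 => k1 k2 i1 i2.
  have eqsz : size (k ++ IJz 32 p2 :: s1 ++ IJmp (p2 + size s2) :: s2) =
      size k + (size s1 + size s2 + 2) by rewrite !size_cat /= ?size_cat /=; lia.
  have pcE : pc + (size k + (size s1 + size s2 + 2)) = p2 + size s2.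
    by rewrite /p2 /p1; lia.
  rewrite eqsz pcE.
  case: eqP => he.
  + have [m2 r2 h2] := IH2 _ _ _ w2 h1 k2.
    exists m2 => //; apply: reach_le_trans (reach_reach_le r1) _; first exact: leqnn.
    apply: (@reach_le_trans _ 1 (size s2)) r2; first by lia.
    by instr_step; rewrite v1 he; apply: reach_le_refl.
  + have [m2 r2 h2] := IH1 _ _ _ w1 h1 k1.
    exists m2 => //; apply: reach_le_trans (reach_reach_le r1) _; first exact: leqnn.
    apply: (@reach_le_trans _ 1 (size s1 + 1)); first by lia.
      instr_step; rewrite v1; case: eqP => // _.
      by apply: reach_le_refl.
    apply: reach_le_trans r2 _; first exact: leqnn.
    by instr_step; apply: reach_le_refl.
Qed.

Definition compile_while (e : exp) (c : cmd) (pc : nat) : seq instr :=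
  let k := compile_exp e 32 in
  let k1 := compile_cmd c (pc + size k).+1 in
  k ++ [:: IJz 32 ((pc + size k).+1 + size k1).+1] ++ k1 ++ [:: IJmp pc].

Lemma compile_whileP P B e c pc N m s : 64 <= B -> wf_exp e 32 -> wf_cmd c ->
  (forall i, i < N -> eval e (iter i (ev c) s) != 0) ->
  eval e (iter N (ev c) s) = 0 ->
  represents B m s -> code_at P pc (compile_while e c pc) ->
  exists2 m', reach_le P (N.+1 * size (compile_while e c pc)) (Cfg pc m)
                (Cfg (pc + size (compile_while e c pc)) m')
    & represents B m' (iter N (ev c) s).
Proof.
move=> hB we wc; elim: N m s => [|N IH] m s hpos hz hm hc.
all: have [ke] := code_at_cat hc.
all: move=> /code_at_cons[i1 /code_at_cat[k1 /code_at_cons[i2 _]]].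
all: have [m1 [r1 v1 f1]] := compile_expP hB (leqnn 32) we hm ke.
all: have h1 := represents_frame hB (leqnn 32) hm f1.
all: have szE : size (compile_while e c pc) = size (compile_exp e 32) +
       (size (compile_cmd c (pc + size (compile_exp e 32)).+1) + 2)
     by rewrite /compile_while !size_cat /= ?size_cat /=; lia.
- rewrite /= in hz; exists m1 => //; rewrite mul1n.
  apply: reach_le_trans (reach_reach_le r1) _; first by rewrite szE; exact: leqnn.
  apply: (@reach_le_trans _ 1 0) (reach_le_refl _ _ _); first by lia.
  instr_step; rewrite v1 hz eqxx szE.
  set q := size (compile_cmd _ _).
  have -> : pc + (size (compile_exp e 32) + (q + 2)) = ((pc + size (compile_exp e 32)).+1 + q).+1 by lia.
  exact: reach_le_refl.
- have [m2 r2 h2] := compile_cmdP hB wc h1 k1.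
  have [||m3 r3 h3] := IH m2 (ev c s) _ _ h2 hc.
  + by move=> i hi; rewrite -iterSr; apply: hpos.
  + by rewrite -iterSr.
  exists m3; last by rewrite iterSr.
  apply: (@reach_le_trans _ (size (compile_while e c pc))
    (N.+1 * size (compile_while e c pc))) r3; first by rewrite [N.+2 * _]mulSn.
  rewrite szE; apply: reach_le_trans (reach_reach_le r1) _; first exact: leqnn.
  have hp := hpos 0 isT; rewrite /= in hp.
  apply: (@reach_le_trans _ 1 (size (compile_cmd c (pc + size (compile_exp e 32)).+1) + 1)).
    by lia.
    by instr_step; rewrite v1 (negbTE hp); apply: reach_le_refl.
  apply: reach_le_trans r2 _; first exact: leqnn.
  by instr_step; apply: reach_le_refl.
Qed.

(** * Programs and the relocation of the input *)

Inductive stmt := SCmd of cmd | SLoop of exp & cmd.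

Definition compile_stmt (st : stmt) (pc : nat) : seq instr :=
  match st with SCmd c => compile_cmd c pc | SLoop e c => compile_while e c pc end.

Definition wf_stmt (st : stmt) : bool :=
  match st with SCmd c => wf_cmd c | SLoop e c => wf_exp e 32 && wf_cmd c end.

Definition run_stmt (x : stmt * nat) (s : state) : state :=
  match x.1 with SCmd c => ev c s | SLoop e c => iter x.2 (ev c) s end.

(** Each statement is paired with a proposed iteration count, so that running a program is a total
    function; this predicate says that the machine leaves the loop exactly at that count. *)
Definition stmt_ok (x : stmt * nat) (s : state) : Prop :=
  match x.1 with
  | SCmd c => True
  | SLoop e c => (forall i, i < x.2 -> eval e (iter i (ev c) s) != 0) /\
                 eval e (iter x.2 (ev c) s) = 0
  end.

Lemma compile_stmtP P B x pc m s : 64 <= B -> wf_stmt x.1 -> stmt_ok x s ->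
  represents B m s -> code_at P pc (compile_stmt x.1 pc) ->
  exists2 m', reach_le P (x.2.+1 * size (compile_stmt x.1 pc)) (Cfg pc m)
                (Cfg (pc + size (compile_stmt x.1 pc)) m')
    & represents B m' (run_stmt x s).
Proof.
case: x => [[c|e c] N] hB /=; rewrite /stmt_ok /run_stmt /=.
  move=> wc _ hm hc; have [m' hr h'] := compile_cmdP hB wc hm hc.
  by exists m' => //; apply: reach_le_trans hr (reach_le_refl _ 0 _); rewrite addn0 leq_pmull.
move=> /andP[we wc] [h1 h2] hm hc.
exact: compile_whileP.
Qed.

Fixpoint compile_stmts (l : seq stmt) (pc : nat) : seq instr :=
  if l is st :: l' then
    let k := compile_stmt st pc in k ++ compile_stmts l' (pc + size k)
  else [::].

Fixpoint run_stmts (l : seq (stmt * nat)) (s : state) : state :=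
  if l is x :: l' then run_stmts l' (run_stmt x s) else s.

Fixpoint stmts_ok (l : seq (stmt * nat)) (s : state) : Prop :=
  if l is x :: l' then stmt_ok x s /\ stmts_ok l' (run_stmt x s) else True.

Lemma compile_stmtsP P B N l pc m s : 64 <= B ->
  all wf_stmt (map fst l) -> all (fun x => x.2 <= N) l -> stmts_ok l s ->
  represents B m s -> code_at P pc (compile_stmts (map fst l) pc) ->
  exists2 m', reach_le P (N.+1 * size (compile_stmts (map fst l) pc)) (Cfg pc m)
                (Cfg (pc + size (compile_stmts (map fst l) pc)) m')
    & represents B m' (run_stmts l s).
Proof.
move=> hB; elim: l pc m s => [|x l IH] pc m s /=.
  by move=> _ _ _ hm _; exists m => //; rewrite addn0; apply: reach_le_refl.
move=> /andP[wx wl] /andP[nx nl] [okx okl] hm /code_at_cat[cx cl].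
have [m1 r1 h1] := compile_stmtP hB wx okx hm cx.
have [m2 r2 h2] := IH _ _ _ wl nl okl h1 cl.
exists m2 => //; rewrite size_cat addnA; apply: reach_le_trans r1 r2.
by rewrite mulnDr leq_add2r leq_mul2r ltnS nx orbT.
Qed.

(* Moves the input out of the way of the registers: cell [i] is copied to
   field 0 of record [i], with heap base [B := 64 * mem[2]].  Cells 0, 1 and 3,
   which serve as registers, are first saved in cells [B], [B - 1], [B - 2]. *)
Definition prologue : seq instr :=
  [:: IAdd 2 2 2; IAdd 2 2 2; IAdd 2 2 2; IAdd 2 2 2; IAdd 2 2 2; IAdd 2 2 2;
      IStore 2 0; IConst 0 1; ISub 0 2 0; IStore 0 1; IConst 1 1; ISub 0 0 1;
      IStore 0 3; IConst 0 0; IAdd 0 0 2;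
      IJz 0 29; ILoad 1 0; IAdd 3 0 0; IAdd 3 3 3; IAdd 3 3 3; IAdd 3 3 2;
      IStore 3 1; IConst 1 1; ISub 0 0 1; IJmp 19].

Lemma prologue_double P pc m : nth IHalt P pc = IAdd 2 2 2 ->
  exists m', [/\ reach_le P 1 (Cfg pc m) (Cfg pc.+1 m'), m' 2 = 2 * m 2 &
    forall i, i != 2 -> m' i = m i].
Proof.
move=> i1; exists (upd m 2 (m 2 + m 2)); split.
- by instr_step; apply: reach_le_refl.
- by rewrite upd_same addnn mul2n.
- by move=> i hi; rewrite upd_neq.
Qed.

Lemma prologue_copy_step P B i m : 3 < B -> code_at P 4 prologue ->
  m 0 = i.+1 -> m 2 = B ->
  exists m', [/\ reach_le P 10 (Cfg 19 m) (Cfg 19 m'), m' 0 = i, m' 2 = B,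
    m' (B + 8 * i.+1) = m i.+1 &
    forall a, 3 < a -> a != B + 8 * i.+1 -> m' a = m a].
Proof.
move=> hB; rewrite /prologue; do 25![case/code_at_cons => ?]; move=> _ m0 m2.
have [ma [ra a0 a1 a2 [a3 ha]]] : exists ma, [/\ reach_le P 6 (Cfg 19 m) (Cfg 25 ma),
    ma 0 = i.+1, ma 1 = m i.+1, ma 2 = B & ma 3 = B + 8 * i.+1 /\
    forall a, 3 < a -> ma a = m a].
  eexists; split.
  - by do 6![instr_step; rewrite ?m0 /=]; apply: reach_le_refl.
  - by rewrite /upd /=.
  - by rewrite /upd /= ?m0.
  - by rewrite /upd /=.
  - split; first by rewrite /upd /= ?m0 ?m2; lia.
    by move=> a ha; rewrite !upd_neq //; lia.
exists (upd (upd (upd ma (ma 3) (ma 1)) 1 1) 0 i); split.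
- apply: reach_le_trans ra (_ : reach_le P 4 _ _) => //.
  do 3 instr_step; instr_step.
  have -> : upd (upd ma (ma 3) (ma 1)) 1 1 0 - upd (upd ma (ma 3) (ma 1)) 1 1 1 = i.
    by rewrite upd_same !upd_neq ?a0 ?subn1 // a3; lia.
  exact: reach_le_refl.
- by rewrite upd_same.
- by rewrite !upd_neq ?a2 ?a3 //; lia.
- rewrite a3 upd_neq; last by lia.
  by rewrite upd_neq ?upd_same //; lia.
- by move=> a h1 h2; rewrite a3 !upd_neq ?ha //; lia.
Qed.

(** Sources lie at or below [B] and targets above it, so no cell is overwritten before it is read.
    The last clause confines the changes to field 0 of the records, which leaves the other fields
    zero. *)
Lemma prologue_copy P B m1 i m : 64 <= B -> i <= B -> code_at P 4 prologue ->
  m 0 = i -> m 2 = B -> (forall j, 4 <= j <= B -> m j = m1 j) ->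
  exists m', [/\ reach_le P (10 * i + 1) (Cfg 19 m) (Cfg 29 m'), m' 2 = B,
    forall j, 4 <= j <= i -> m' (B + 8 * j) = m1 j &
    forall a, 3 < a -> ~~ [&& B < a, 8 %| a - B & a <= B + 8 * i] -> m' a = m a].
Proof.
move=> hB hi hc; elim: i hi m => [|i IH] hi m m0 m2 hm.
  move: hc; rewrite /prologue; do 25![case/code_at_cons => ?]; move=> _.
  exists m; split=> //; first by instr_step; rewrite m0; apply: reach_le_refl.
  by move=> j; lia.
have hB3 : 3 < B by apply: leq_trans hB.
have [mm [r a0 a2 ai ha]] := prologue_copy_step hB3 hc m0 m2.
have [|m' [r' m'2 h1 h2]] := IH (ltnW hi) mm a0 a2.
  by move=> j hj; rewrite ha ?hm //; lia.
exists m'; split=> //.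
- by apply: reach_le_trans r r'; lia.
- move=> j hj; case: (eqVneq j i.+1) => [->|ne]; last by apply: h1; lia.
  by rewrite h2 ?ai ?hm //; lia.
- by move=> a h3 h4; rewrite h2 ?ha //; lia.
Qed.

Lemma prologueP P m0 : code_at P 4 prologue -> 0 < m0 2 ->
  (forall i, 3 + 3 * m0 2 <= i -> m0 i = 0) ->
  let B := 64 * m0 2 in
  exists m', [/\ reach_le P (10 * B + 16) (Cfg 4 m0) (Cfg 29 m'), m' 2 = B,
    [/\ m' (B + 8 * B) = m0 0, m' (B + 8 * (B - 1)) = m0 1 & m' (B + 8 * (B - 2)) = m0 3],
    forall j, 4 <= j < 3 + 3 * m0 2 -> m' (B + 8 * j) = m0 j &
    forall p f, 0 < f < 8 -> m' (B + 8 * p + f) = 0].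
Proof.
move=> hc hm hz B; have hB : 64 <= B by rewrite /B; lia.
have := hc; rewrite /prologue; do 25![case/code_at_cons => ?]; move=> _.
have [ma [ra a2 ha]] : exists ma, [/\ reach_le P 6 (Cfg 4 m0) (Cfg 10 ma), ma 2 = B &
    forall i, i != 2 -> ma i = m0 i].
  have dbl pc m := @prologue_double P pc m.
  have [|m1 [r1 e1 h1]] := dbl 4 m0 => //.
  have [|m2 [r2 e2 h2]] := dbl 5 m1 => //.
  have [|m3 [r3 e3 h3]] := dbl 6 m2 => //.
  have [|m4 [r4 e4 h4]] := dbl 7 m3 => //.
  have [|m5 [r5 e5 h5]] := dbl 8 m4 => //.
  have [|m6 [r6 e6 h6]] := dbl 9 m5 => //.
  exists m6; split; last by move=> i hi; rewrite h6 // h5 // h4 // h3 // h2 // h1.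
    apply: (@reach_le_trans _ 1 5) r1 _ => //.
    apply: (@reach_le_trans _ 1 4) r2 _ => //.
    apply: (@reach_le_trans _ 1 3) r3 _ => //.
    apply: (@reach_le_trans _ 1 2) r4 _ => //.
    by apply: (@reach_le_trans _ 1 1) r5 r6.
  by rewrite e6 e5 e4 e3 e2 e1 /B; lia.
have [mb [rb b0 b2 [bB bB1 bB2] hb]] : exists mb, [/\ reach_le P 9 (Cfg 10 ma) (Cfg 19 mb),
    mb 0 = B, mb 2 = B, [/\ mb B = m0 0, mb (B - 1) = m0 1 & mb (B - 2) = m0 3] &
    forall i, 3 < i -> i \notin [:: B; B - 1; B - 2] -> mb i = m0 i].
  pose mc := upd (upd (upd ma B (m0 0)) 0 1) 0 (B - 1).
  have c0 : mc 0 = B - 1 by rewrite /mc upd_same.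
  have c1 : mc 1 = m0 1 by rewrite /mc !upd_neq ?ha //; lia.
  pose md := upd (upd (upd mc (B - 1) (m0 1)) 1 1) 0 (B - 2).
  have d0 : md 0 = B - 2 by rewrite /md upd_same.
  have d3 : md 3 = m0 3 by rewrite /md /mc !upd_neq ?ha //; lia.
  have d2 : md 2 = B by rewrite /md /mc !upd_neq ?a2 //; lia.
  exists (upd (upd (upd md (B - 2) (m0 3)) 0 0) 0 B); split.
  - apply: (@reach_le_trans _ 3 6 _ _ (Cfg 13 mc)) => //.
      instr_step; rewrite a2 ha //; instr_step; instr_step.
      have -> : upd (upd ma B (m0 0)) 0 1 2 - upd (upd ma B (m0 0)) 0 1 0 = B - 1.
        by rewrite upd_same !upd_neq ?a2 //; lia.
      exact: reach_le_refl.
    apply: (@reach_le_trans _ 3 3 _ _ (Cfg 16 md)) => //.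
      instr_step; rewrite c0 c1; instr_step; instr_step.
      set q := (X in upd _ 0 X).
      have -> : q = B - 2 by rewrite /q upd_same !upd_neq ?c0 //; lia.
      exact: reach_le_refl.
    instr_step; rewrite d0 d3; instr_step; instr_step.
    set q := (X in upd _ 0 X).
    have -> : q = B by rewrite /q upd_same !upd_neq ?d2 //; lia.
    exact: reach_le_refl.
  - by rewrite upd_same.
  - by rewrite !upd_neq ?d2 //; lia.
  - split.
    + rewrite upd_neq ?upd_neq ?upd_neq; try lia.
      by rewrite /md /mc 5?upd_neq ?upd_same //; lia.
    + rewrite upd_neq ?upd_neq ?upd_neq; try lia.
      by rewrite /md 2?upd_neq ?upd_same //; lia.
    + by rewrite 2?upd_neq ?upd_same //; lia.
  - move=> i hi; rewrite !inE => hB3.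
    by rewrite /md /mc !upd_neq ?ha //; lia.
have [m' [r' m'2 h1 h2]] := prologue_copy hB (leqnn B) hc b0 b2 (fun j _ => erefl).
(* The factor 64 puts the three saved cells beyond the input and the base above registers and
   stack. *)
have hB3 : B >= 3 + 3 * m0 2 + 3 by rewrite /B; lia.
exists m'; split=> //.
- by apply: reach_le_trans ra (reach_le_trans (leqnn _) rb r'); lia.
- by split; rewrite h1 //; lia.
- by move=> j hj; rewrite h1 ?hb // ?inE; lia.
- move=> p f /andP[f0 f8].
  have hA : B + 8 * p + f >= B.+1 by clear -f0; lia.
  have le : 3 + 3 * m0 2 <= B + 8 * p + f by clear -hA hB3; lia.
  rewrite h2; first 1 last.
  - by clear -le hm; lia.
  - by rewrite -[_ + f]addnA addKn dvdn_addr ?dvdn_mulr // gtnNdvd // andbF.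
  rewrite hb; first by rewrite hz.
    by clear -le hm; lia.
  by rewrite !inE; clear -hA; lia.
Qed.

(** * The three loops *)

(** Subtraction is truncated: [1 - e] tests for zero, and the sum of the two differences vanishes
    only for equal values. *)
Definition ENot e := ESub (ECst 1) e.
Definition EAnd a b := ENot (EAdd (ENot a) (ENot b)).
Definition ENeq a b := EAdd (ESub a b) (ESub b a).

Lemma eval_and a b s : eval (EAnd a b) s = (eval a s != 0) && (eval b s != 0).
Proof. by rewrite /=; case: (eval a s) => [|i]; case: (eval b s) => [|j]. Qed.

Lemma eval_neq0 a b s : (eval (ENeq a b) s != 0) = (eval a s != eval b s).
Proof. by rewrite /=; lia. Qed.

(** * First loop: storing the neighbours *)

Definition insert (f : nat) : cmd :=
  CSeq (CIf (ELd (EVar 8) f) (CSto (EVar 8) f.+1 (EVar 9)) (CSto (EVar 8) f (EVar 9)))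
       (CIf (ELd (EVar 9) f) (CSto (EVar 9) f.+1 (EVar 8)) (CSto (EVar 9) f (EVar 8))).

(* Records of vertices: fields 1 and 2 hold the red neighbours, 3 and 4 the blue
   ones, 5 is the alive flag, 6 and 7 the red and blue neighbour if it is unique.
   Registers: 3 is [n], 4 is [k], 5 a loop counter, 6 a record, 7 the result. *)
Definition read_edge : cmd :=
  CSeq (CAsg 8 (EAdd (ELd (EVar 6) 0) (ECst 1)))
 (CSeq (CAsg 9 (EAdd (ELd (EAdd (EVar 6) (ECst 1)) 0) (ECst 1)))
 (CSeq (CIf (ELd (EAdd (EVar 6) (ECst 2)) 0) (insert 3) (insert 1))
 (CSeq (CAsg 6 (EAdd (EVar 6) (ECst 3)))
       (CAsg 5 (ESub (EVar 5) (ECst 64)))))).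

(** Vertex numbers start from 1, so 0 marks a free field; the degree bound ensures that two fields
    per colour suffice. *)
Definition hpush (h : nat -> nat -> nat) p f v : nat -> nat -> nat :=
  if h p f == 0 then hupd h p f v else hupd h p f.+1 v.

Lemma ev_if e c1 c2 s : ev (CIf e c1 c2) s = if eval e s == 0 then ev c2 s else ev c1 s.
Proof. by []. Qed.

Lemma ev_insert f s :
  ev (insert f) s = State (reg s)
    (hpush (hpush (heap s) (reg s 8) f (reg s 9)) (reg s 9) f (reg s 8)).
Proof.
by rewrite /hpush /=; case: (heap s (reg s 8) f == 0) => /=; case: (_ == 0).
Qed.

Definition fld (c : bool) : nat := if c then 3 else 1.

Lemma ev_read_edge s a b (c : bool) :
  heap s (reg s 6) 0 = a -> heap s (reg s 6 + 1) 0 = b -> heap s (reg s 6 + 2) 0 = c ->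
  [/\ reg (ev read_edge s) 6 = reg s 6 + 3, reg (ev read_edge s) 5 = reg s 5 - 64,
      forall r, r < 5 -> reg (ev read_edge s) r = reg s r &
      heap (ev read_edge s) =
      hpush (hpush (heap s) a.+1 (fld c) b.+1) b.+1 (fld c) a.+1].
Proof.
move=> ha hb hc; rewrite /read_edge.
set s1 := ev (CAsg 8 (EAdd (ELd (EVar 6) 0) (ECst 1))) s.
set s2 := ev (CAsg 9 (EAdd (ELd (EAdd (EVar 6) (ECst 1)) 0) (ECst 1))) s1.
set s3 := ev (CIf (ELd (EAdd (EVar 6) (ECst 2)) 0) (insert 3) (insert 1)) s2.
have e2 : s2 = State (upd (upd (reg s) 8 a.+1) 9 b.+1) (heap s).
  rewrite /s2 /s1 /= /upd /=; congr State; rewrite !addn1 ha.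
  by move: hb; rewrite addn1 => ->.
have e3 : s3 = State (reg s2) (hpush (hpush (heap s) a.+1 (fld c) b.+1) b.+1 (fld c) a.+1).
  have -> : s3 = ev (insert (fld c)) s2.
    have e : eval (ELd (EAdd (EVar 6) (ECst 2)) 0) s2 = c by rewrite e2 /= /upd /= hc.
    rewrite /s3 ev_if e.
    by case: (c).
  by rewrite ev_insert e2 /= /upd /=.
change (ev _ s) with (ev (CSeq (CAsg 6 (EAdd (EVar 6) (ECst 3)))
       (CAsg 5 (ESub (EVar 5) (ECst 64)))) s3).
rewrite e3 e2 /= /upd /=; split=> // r hr.
by do 5![case: r hr => [|r] hr //=].
Qed.

Section Loops.
Variable n : nat.
Notation edges := (seq ('I_n * 'I_n * bool)).

Definition ends (x : 'I_n * 'I_n * bool) (v : 'I_n) (c : bool) : seq 'I_n :=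
  if x.2 == c then (if x.1.1 == v then [:: x.1.2] else [::]) ++
                   (if x.1.2 == v then [:: x.1.1] else [::])
  else [::].

Definition nbl (L : edges) v c : seq 'I_n := flatten [seq ends x v c | x <- L].

Definition slot (l : seq 'I_n) i := nth 0 [seq (val u).+1 | u <- l] i.

Definition slots_ok (L : edges) (h : nat -> nat -> nat) :=
  forall v c, h (val v).+1 (fld c) = slot (nbl L v c) 0 /\
              h (val v).+1 (fld c).+1 = slot (nbl L v c) 1.

Lemma nbl_rcons L x v c : nbl (rcons L x) v c = nbl L v c ++ ends x v c.
Proof. by rewrite /nbl map_rcons flatten_rcons. Qed.

Lemma hpush_frame h p f v q g : (q != p) || ((g != f) && (g != f.+1)) ->
  hpush h p f v q g = h q g.
Proof.
rewrite /hpush /hupd => hn; case: ifP => _; case: ifP => // /andP[/eqP e1 /eqP e2].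
  by move: hn; rewrite e1 e2 !eqxx.
by move: hn; rewrite e1 e2 !eqxx andbF.
Qed.

Lemma hpush_slot h p f l v : size l <= 1 -> h p f = slot l 0 -> h p f.+1 = slot l 1 ->
  hpush h p f (val v).+1 p f = slot (l ++ [:: v]) 0 /\
  hpush h p f (val v).+1 p f.+1 = slot (l ++ [:: v]) 1.
Proof.
case: l => [|u [|? ?]] //= _; rewrite /slot /= => e1 e2.
  by rewrite /hpush e1 /hupd /= !eqxx (gtn_eqF (ltnSn f)) e2.
by rewrite /hpush e1 /hupd /= !eqxx (ltn_eqF (ltnSn f)) ?e1.
Qed.

Lemma slots_push L h (a b : 'I_n) c : a != b ->
  (forall v c', size (nbl (rcons L (a, b, c)) v c') <= 2) -> slots_ok L h ->
  slots_ok (rcons L (a, b, c))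
    (hpush (hpush h (val a).+1 (fld c) (val b).+1) (val b).+1 (fld c) (val a).+1).
Proof.
move=> ab hs ok v c'; have := hs v c'; rewrite nbl_rcons /ends /=.
have [e1 e2] := ok v c'.
have nf g : c != c' -> (g == fld c') || (g == (fld c').+1) ->
    (g != fld c) && (g != (fld c).+1).
  by case: (c); case: (c') => //= _ /orP[]/eqP->.
case: eqP => [ec|/eqP cc]; last first.
  rewrite cats0 !hpush_frame ?(nf _ cc) ?eqxx ?orbT //.
rewrite -{}ec in e1 e2 *; have va x : ((val v).+1 == (val x).+1) = (x == v).
  by rewrite eqSS val_eqE eq_sym.
have av x : x == v -> (val x).+1 = (val v).+1 by move/eqP->.
case: (eqVneq a v) => [e|nav].
  have bv : (b == v) = false by rewrite -e eq_sym (negbTE ab).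
  rewrite bv size_cat /= addn1 ltnS => sz.
  have vb : (val v).+1 != (val b).+1 by rewrite va bv.
  rewrite e !(@hpush_frame _ (val b).+1) ?vb //.
  exact: hpush_slot.
case: (eqVneq b v) => [e|nbv] /=.
  rewrite size_cat /= addn1 ltnS => sz.
  by rewrite e; apply: hpush_slot; rewrite ?hpush_frame ?va ?nav.
by rewrite cats0 !hpush_frame ?va ?nav ?nbv //.
Qed.

(** The input sits in field 0 and neighbours go to fields 1 to 4, so edges still to be read stay
    intact. The counter drops by 64 because the edge count survives only as the heap base
    [64 * size es]. *)
Lemma read_edges_inv (es : edges) x0 s0 k : k <= size es ->
  (forall x, x \in es -> x.1.1 != x.1.2) ->
  (forall j v c, size (nbl (take j es) v c) <= 2) ->
  reg s0 6 = 3 -> reg s0 5 = 64 * size es ->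
  (forall j, j < size es ->
     [/\ heap s0 (3 + 3 * j) 0 = (nth x0 es j).1.1,
         heap s0 (3 + 3 * j + 1) 0 = (nth x0 es j).1.2 &
         heap s0 (3 + 3 * j + 2) 0 = (nth x0 es j).2]) ->
  (forall p f, 0 < f < 8 -> heap s0 p f = 0) ->
  let s := iter k (ev read_edge) s0 in
  [/\ reg s 6 = 3 + 3 * k, reg s 5 = 64 * (size es - k),
      forall r, r < 5 -> reg s r = reg s0 r & slots_ok (take k es) (heap s)] /\
  [/\ forall p, heap s p 0 = heap s0 p 0, forall p f, 4 < f < 8 -> heap s p f = 0 &
      forall p f, (forall v : 'I_n, p != (val v).+1) -> 0 < f < 8 -> heap s p f = 0].
Proof.
move=> + hne hsz r6 r5 hin hz; elim: k => [_|k IH lt] s.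
  rewrite {}/s /= r6 r5 subn0 take0; split; split=> //; try by move=> *; apply: hz; lia.
  by move=> v c; split; rewrite hz /slot //; case: c.
have [[i6 i5 ir iS] [i0 iz ip]] := IH (ltnW lt); set t := iter k _ s0 in i6 i5 ir iS i0 iz ip.
rewrite {}/s iterS -/t.
have [h1 h2 h3] := hin k lt; set x := nth x0 es k in h1 h2 h3.
have [e6 e5 er eh] : [/\ reg (ev read_edge t) 6 = reg t 6 + 3,
    reg (ev read_edge t) 5 = reg t 5 - 64,
      forall r, r < 5 -> reg (ev read_edge t) r = reg t r &
      heap (ev read_edge t) =
      hpush (hpush (heap t) (val x.1.1).+1 (fld x.2) (val x.1.2).+1) (val x.1.2).+1 (fld x.2) (val x.1.1).+1].
  by apply: ev_read_edge; rewrite i6 i0.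
have fr p f : (forall v : 'I_n, p != (val v).+1) \/ ~~ (0 < f < 5) ->
    heap (ev read_edge t) p f = heap t p f.
  rewrite eh => -[hp|hf]; first by rewrite !hpush_frame ?hp.
  by rewrite !hpush_frame // /fld; apply/orP; right; case: (x.2); lia.
split; split.
- by rewrite e6 i6; lia.
- by rewrite e5 i5; lia.
- by move=> r hr; rewrite er // ir.
- rewrite (take_nth x0) // -/x eh.
  have xe : x = (x.1.1, x.1.2, x.2) by case: (x) => -[].
  rewrite {1}xe; apply: slots_push => //; first by apply: hne; apply: mem_nth.
  by move=> v c; rewrite -xe /x -take_nth.
- by move=> p; rewrite fr ?i0 //; right.
- by move=> p f hf; rewrite fr ?iz //; right; lia.
- by move=> p f hp hf; rewrite fr ?ip //; left.
Qed.
End Loops.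

(** * Second loop: centers, costs and lone neighbours *)

Lemma eval_not e s : eval (ENot e) s = (eval e s == 0).
Proof. by rewrite /=; case: (eval e s) => [|[|i]]. Qed.

Lemma ev_seq c1 c2 s : ev (CSeq c1 c2) s = ev c2 (ev c1 s).
Proof. by []. Qed.

Lemma ev_asg x e s : ev (CAsg x e) s = State (upd (reg s) x (eval e s)) (heap s).
Proof. by []. Qed.

Lemma ev_sto a f e s :
  ev (CSto a f e) s = State (reg s) (hupd (heap s) (eval a s) f (eval e s)).
Proof. by []. Qed.

Definition conflict_exp (i j : nat) : exp :=
  let a := ELd (EVar 6) i in
  let b := ELd (EVar 6) j in
  EAnd (EAnd a b) (EAnd (EAnd (ENeq (ELd a 1) b) (ENeq (ELd a 2) b))
                        (EAnd (ENeq (ELd a 3) b) (ENeq (ELd a 4) b))).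

Definition center_exp : exp :=
  EAdd (EAdd (conflict_exp 1 3) (conflict_exp 1 4))
       (EAdd (conflict_exp 2 3) (conflict_exp 2 4)).

(** Register 7 collects twice the deletion cost: 1 for each center, and 2 more when both second
    neighbour fields are filled, that is, at a bow. *)
Definition mark_center : cmd :=
  CIf center_exp
    (CSeq (CSto (EVar 6) 5 (ECst 1))
          (CIf (EAnd (ELd (EVar 6) 2) (ELd (EVar 6) 4))
             (CAsg 7 (EAdd (EVar 7) (ECst 3))) (CAsg 7 (EAdd (EVar 7) (ECst 1)))))
    CSkip.

Definition mark_lone : cmd :=
  CSeq (CIf (ELd (EVar 6) 2) CSkip (CSto (EVar 6) 6 (ELd (EVar 6) 1)))
       (CIf (ELd (EVar 6) 4) CSkip (CSto (EVar 6) 7 (ELd (EVar 6) 3))).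

Definition next_vertex : cmd :=
  CSeq (CAsg 6 (EAdd (EVar 6) (ECst 1))) (CAsg 5 (ESub (EVar 5) (ECst 1))).

Definition inspect_vertex : cmd := CSeq mark_center (CSeq mark_lone next_vertex).

Definition conflict_test (h : nat -> nat -> nat) x y : bool :=
  [&& (x != 0), (y != 0), h x 1 != y, h x 2 != y, h x 3 != y & h x 4 != y].

Lemma eval_conflict i j s :
  eval (conflict_exp i j) s =
  conflict_test (heap s) (heap s (reg s 6) i) (heap s (reg s 6) j).
Proof.
by rewrite /conflict_exp !eval_and !eqb0 !negbK !eval_neq0 /conflict_test -!andbA.
Qed.

Section Inspect.
Variables (n : nat) (es : seq ('I_n * 'I_n * bool)).

Definition nrel (c : bool) : rel 'I_n := fun v w => w \in nbl es v c.
Definition lone_nbr (c : bool) (v : 'I_n) : option 'I_n :=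
  if nbl es v c is [:: w] then Some w else None.

Hypothesis nbl_uniq : forall v c, uniq (nbl es v c).
Hypothesis nbl_size : forall v c, size (nbl es v c) <= 2.

Notation r := (nrel false).
Notation b := (nrel true).

Lemma slot_mem (l : seq 'I_n) (w : 'I_n) : size l <= 2 ->
  (w \in l) = (slot l 0 == w.+1) || (slot l 1 == w.+1).
Proof.
by case: l => [|x [|y [|? ?]]] //= _; rewrite /slot /= ?inE ?eqSS ?orbF ?(eq_sym w).
Qed.

Lemma conflict_testE h (u w : 'I_n) : slots_ok es h ->
  conflict_test h u.+1 w.+1 = ~~ adj r b u w.
Proof.
move=> ok; rewrite /conflict_test /adj /nrel !slot_mem ?nbl_size //.
have [/= e1 e2] := ok u false; have [/= e3 e4] := ok u true.
by rewrite e1 e2 e3 e4 !negb_or -!andbA.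
Qed.

(** With at most two neighbours per colour, the quantifiers reduce to four pairs of fields; an empty
    field is 0 and fails the test. *)
Lemma eval_center s (v : 'I_n) : slots_ok es (heap s) -> reg s 6 = v.+1 ->
  (eval center_exp s != 0) = center r b v.
Proof.
move=> ok e6.
have -> : center r b v =
    has (fun x => has (fun y => ~~ adj r b x y) (nbl es v true)) (nbl es v false).
  apply/centerP/hasP => [[x [y /and3P[h1 h2 h3]]]|[x h1 /hasP[y h2 h3]]].
    by exists x => //; apply/hasP; exists y.
  by exists x, y; apply/and3P.
rewrite -[eval _ s]/(eval (conflict_exp 1 3) s + eval (conflict_exp 1 4) s +
   (eval (conflict_exp 2 3) s + eval (conflict_exp 2 4) s)) !eval_conflict e6.
have [/= -> ->] := ok v false; have [/= -> ->] := ok v true.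
have t0 y : conflict_test (heap s) 0 y = false by [].
have t1 x : conflict_test (heap s) x 0 = false by rewrite /conflict_test andbF.
have := nbl_size v false; have := nbl_size v true.
case: (nbl es v false) => [|x [|x' [|? ?]]] //=;
case: (nbl es v true) => [|y [|y' [|? ?]]] //= _ _;
rewrite /slot /= ?t0 ?t1 ?conflict_testE ?orbF //=;
repeat case: (adj _ _ _ _) => //=.
Qed.

Lemma slot1E v c : (slot (nbl es v c) 1 != 0) = (1 < deg (nrel c) v).
Proof.
have -> : deg (nrel c) v = size (nbl es v c).
  by rewrite /deg cardsE /nrel; apply/card_uniqP/nbl_uniq.
by rewrite /slot; case: (nbl es v c) => [|x [|y l]].
Qed.

Lemma lone_nbrE v c : slot (nbl es v c) 1 == 0 ->
  slot (nbl es v c) 0 = onat (lone_nbr c v).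
Proof. by rewrite /slot /lone_nbr; case: (nbl es v c) => [|x [|y l]]. Qed.

Lemma lone_nbr_None v c : slot (nbl es v c) 1 != 0 -> lone_nbr c v = None.
Proof. by rewrite /slot /lone_nbr; case: (nbl es v c) => [|x [|y l]]. Qed.

Definition cost (v : 'I_n) : nat := center r b v * (1 + 2 * bow r b v).

Definition inspected (h : nat -> nat -> nat) (v : 'I_n) f :=
  if f == 5 then nat_of_bool (center r b v)
  else if f == 6 then onat (lone_nbr false v)
  else if f == 7 then onat (lone_nbr true v)
  else h v.+1 f.

Lemma ev_inspect s (v : 'I_n) : slots_ok es (heap s) -> reg s 6 = v.+1 ->
  (forall f, 4 < f < 8 -> heap s v.+1 f = 0) ->
  [/\ reg (ev inspect_vertex s) 6 = reg s 6 + 1, reg (ev inspect_vertex s) 5 = reg s 5 - 1,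
      reg (ev inspect_vertex s) 7 = reg s 7 + cost v,
      forall q, q < 5 -> reg (ev inspect_vertex s) q = reg s q &
      (forall p f, p != v.+1 -> heap (ev inspect_vertex s) p f = heap s p f) /\
      (forall f, heap (ev inspect_vertex s) v.+1 f = inspected (heap s) v f)].
Proof.
move=> ok e6 hz; rewrite -[ev _ s]/(ev next_vertex (ev mark_lone (ev mark_center s))).
set s1 := ev mark_center s.
have := ok v false; have := ok v true; rewrite /fld => -[f3 f4] [f1 f2].
have [h1 r1] : heap s1 = (if center r b v then hupd (heap s) v.+1 5 1 else heap s) /\
    reg s1 = (if center r b v then upd (reg s) 7 (reg s 7 + cost v) else reg s).
  rewrite /s1 ev_if -[_ == 0]negbK (eval_center ok e6).
  rewrite /cost; case cv: (center r b v); last by split.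
  rewrite ev_seq ev_sto ev_if eval_and.
  have -> : bow r b v = (slot (nbl es v false) 1 != 0) && (slot (nbl es v true) 1 != 0).
    by rewrite !slot1E /bow cv.
  rewrite [~~ true]/= [eval (ELd _ 2) _]/= [eval (ELd _ 4) _]/= /hupd e6 !andbF f2 f4.
  by case: (slot _ _) => [|i]; case: (slot _ _) => [|j]; rewrite /= ?e6.
have h1f f : f < 5 -> heap s1 v.+1 f = heap s v.+1 f.
  by move=> hf; rewrite h1; case: ifP => // _; rewrite /hupd; case: eqP => //= _; case: eqP hf => // ->.
have r1f q : q != 7 -> reg s1 q = reg s q.
  by move=> hq; rewrite r1; case: ifP => // _; rewrite upd_neq.
have e7 : reg s1 7 = reg s 7 + cost v.
  by rewrite r1; case: ifP => cv; rewrite ?upd_same // /cost cv addn0.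
clearbody s1; set s2 := ev mark_lone s1.
have [h2 r2] : reg s2 = reg s1 /\ forall p f, heap s2 p f =
    if (p == v.+1) && (f == 6) then onat (lone_nbr false v) else
    if (p == v.+1) && (f == 7) then onat (lone_nbr true v) else heap s1 p f.
  have z6 : heap s1 v.+1 6 = 0 by rewrite h1; case: ifP => _; rewrite /hupd /= ?andbF hz.
  have z7 : heap s1 v.+1 7 = 0 by rewrite h1; case: ifP => _; rewrite /hupd /= ?andbF hz.
  rewrite /s2 /mark_lone; set m1 := CIf _ _ _; set m2 := CIf _ _ _.
  rewrite -[ev _ s1]/(ev m2 (ev m1 s1)).
  have [g1 g2] : reg (ev m1 s1) = reg s1 /\ forall p f, heap (ev m1 s1) p f =
      if (p == v.+1) && (f == 6) then onat (lone_nbr false v) else heap s1 p f.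
    rewrite /m1 ev_if /= r1f // e6 h1f // f2; case: eqP => [/eqP e|/eqP e] /=; split=> // p f.
      by rewrite /hupd ?h1f // f1 lone_nbrE.
    by case: ifP => // /andP[/eqP-> /eqP->]; rewrite z6 lone_nbr_None.
  move: (ev m1 s1) g1 g2 => t g1 g2; rewrite /m2 ev_if /= g1 r1f // e6 g2 /= andbF h1f // f4.
  case: eqP => [/eqP e|/eqP e] /=; split=> // p f.
    rewrite /hupd !g2 ?andbF /= ?h1f // f3 lone_nbrE //.
    by case: (p == _) => //=; case: (f =P 7) => // ->.
  by rewrite g2; case: ifP => // _; case: ifP => // /andP[/eqP-> /eqP->]; rewrite z7 lone_nbr_None.
clearbody s2; rewrite /= /upd /= h2; split=> //; rewrite ?r1f //.
- by move=> q hq; do 5![case: q hq => [|q] hq; first by rewrite /= r1f].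
split=> [p f hp|f].
  rewrite r2 (negbTE hp) h1.
  by case: ifP => // _; rewrite /hupd (negbTE hp).
rewrite r2 eqxx /= /inspected h1.
case: (f =P 5) => [->|ne] /=.
  by case: ifP => _; rewrite /hupd ?eqxx ?hz.
case: ifP => // _; case: ifP => // _; case: ifP => // _.
by rewrite /hupd (introF eqP ne) andbF.
Qed.

Lemma inspect_inv s0 k : k <= n -> slots_ok es (heap s0) ->
  reg s0 6 = 1 -> reg s0 5 = n -> reg s0 7 = 0 ->
  (forall p f, 4 < f < 8 -> heap s0 p f = 0) ->
  let s := iter k (ev inspect_vertex) s0 in
  [/\ reg s 6 = k.+1, reg s 5 = n - k, reg s 7 = \sum_(v < n | v < k) cost v,
      forall q, q < 5 -> reg s q = reg s0 q & slots_ok es (heap s)] /\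
  [/\ forall v : 'I_n, k <= v -> forall f, 4 < f < 8 -> heap s v.+1 f = 0,
      forall v : 'I_n, v < k -> forall f, 4 < f < 8 -> heap s v.+1 f = inspected (heap s0) v f &
      forall p f, vert n p = None -> heap s p f = heap s0 p f].
Proof.
move=> + ok r6 r5 r7 hz; elim: k => [_|k IH lt] s.
  rewrite {}/s /= r6 r5 r7 subn0 big_pred0 //; split; split=> // v _ f; exact: hz.
have [[i6 i5 i7 ir iS] [i0 i1 i2]] := IH (ltnW lt).
set t := iter k _ s0 in i6 i5 i7 ir iS i0 i1 i2.
rewrite {}/s iterS -/t; pose v := Ordinal lt.
have [e6 e5 e7 er [eh1 eh2]] := ev_inspect (v := v) iS i6 (i0 v (leqnn _)).
have vS (u : 'I_n) : (u.+1 == v.+1) = (u == v) by rewrite eqSS.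
have hS (u : 'I_n) f : f < 5 -> heap (ev inspect_vertex t) u.+1 f = heap t u.+1 f.
  move=> hf; have [->|ne] := eqVneq u v; last by rewrite eh1 // vS.
  by rewrite eh2 /inspected; do 3![case: eqP hf => [->|_ hf] //].
split; split.
- by rewrite e6 i6 addn1.
- by rewrite e5 i5; lia.
- rewrite e7 i7 [RHS](bigD1 v) //= addnC; congr (_ + _); apply: eq_bigl => u.
  by rewrite ltnS ltn_neqAle -val_eqE andbC.
- by move=> q hq; rewrite er ?ir.
- by move=> u c; rewrite !hS; [apply: iS | case: (c) | case: (c)].
- by move=> u hu f hf; rewrite eh1 ?i0 // ?vS -?val_eqE /=; lia.
- move=> u; rewrite ltnS leq_eqVlt => /orP[/eqP/(@ord_inj n u v)->|hu] f hf.
    rewrite eh2 /inspected; case: ifP => // f5; case: ifP => // f6; case: ifP => // f7.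
    by lia.
  by rewrite eh1 ?i1 // vS -val_eqE /=; lia.
- move=> p f hp; rewrite eh1 ?i2 //; apply: contra_eqN hp => /eqP->.
  by rewrite vertS.
Qed.

End Inspect.

(** * Third loop: peeling on the machine *)

Definition partner_cmd (x k : nat) : cmd :=
  CSeq (CAsg x (ELd (EVar 11) k)) (CIf (ELd (EVar x) 5) CSkip (CAsg x (ECst 0))).

(** It is reached only when at most one partner is present, so the sum of registers 12 and 13 is the
    number of that partner, or 0 for a single center. *)
Definition remove_current : cmd :=
  CSeq (CSto (EVar 11) 5 (ECst 0))
 (CSeq (CAsg 14 (EAdd (EVar 12) (EVar 13)))
  (CIf (EVar 14)
    (CSeq (CSto (EVar 14) 5 (ECst 0))
          (CAsg 11 (ESub (EAdd (ELd (EVar 14) 6) (ELd (EVar 14) 7)) (EVar 11))))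
    (CSeq (CAsg 7 (EAdd (EVar 7) (ECst 1))) (CAsg 11 (ECst 0))))).

Definition next_scan : cmd :=
  CSeq (CAsg 11 (EVar 6)) (CAsg 6 (EAdd (EVar 6) (ECst 1))).

Definition peel_cmd : cmd :=
  CSeq (partner_cmd 12 6)
 (CSeq (partner_cmd 13 7)
 (CSeq (CIf (EAnd (ELd (EVar 11) 5) (ENot (EAnd (EVar 12) (EVar 13)))) remove_current next_scan)
       (CAsg 5 (ESub (EVar 5) (ECst 1))))).

Section Peel.
Variables (n : nat) (f g : 'I_n -> option 'I_n).

(** [d] is the sum of costs already in the register that goes on to count singles. The last clause
    treats 0 and the numbers above [n], which the scan may reach, as dead vertices. *)
Definition peel_rel (d : nat) (s : state) (t : pstate n) : Prop :=
  [/\ reg s 11 = cur t, reg s 6 = scan t & reg s 7 = d + singles t] /\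
  [/\ forall v : 'I_n, heap s v.+1 5 = (v \in alive t),
      forall v : 'I_n, heap s v.+1 6 = onat (f v),
      forall v : 'I_n, heap s v.+1 7 = onat (g v) &
      forall p, vert n p = None -> heap s p 5 = 0].

(** Record 0 has alive flag 0, so a missing neighbour and a dead one both give 0 by the same
    test. *)
Lemma ev_partner (A : {set 'I_n}) s x k h : x != 11 ->
  (forall v : 'I_n, heap s v.+1 5 = (v \in A)) -> heap s 0 5 = 0 ->
  (forall v : 'I_n, heap s v.+1 k = onat (h v)) ->
  [/\ heap (ev (partner_cmd x k) s) = heap s,
      forall q, q != x -> reg (ev (partner_cmd x k) s) q = reg s q &
      forall v : 'I_n, reg s 11 = v.+1 -> reg (ev (partner_cmd x k) s) x = onat (partner A h v)].
Proof.
move=> nx hA h0 hk; rewrite /partner_cmd ev_seq ev_asg ev_if /= upd_same.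
split; first by case: ifP.
  by move=> q hq; case: ifP => _ /=; rewrite !upd_neq.
move=> v ->; rewrite hk /partner; case: (h v) => [w|] /=.
  by rewrite hA; case: (w \in A); rewrite /= upd_same.
by rewrite h0 /= upd_same.
Qed.

Lemma hupd5_alive s (A : {set 'I_n}) (v : 'I_n) :
  (forall u : 'I_n, heap s u.+1 5 = (u \in A)) ->
  forall u : 'I_n, hupd (heap s) v.+1 5 0 u.+1 5 = (u \in A :\ v).
Proof.
move=> hA u; rewrite /hupd !inE eqSS andbT -[u == v]val_eqE /= hA.
by case: eqP.
Qed.

Lemma ev_peel d s t : peel_rel d s t ->
  [/\ peel_rel d (ev peel_cmd s) (peel_step f g t),
      reg (ev peel_cmd s) 5 = reg s 5 - 1 &
      forall q, q < 5 -> reg (ev peel_cmd s) q = reg s q].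
Proof.
move=> [[r11 r6 r7] [h5 h6 h7 hN]]; have h0 := hN 0 erefl.
rewrite /peel_cmd ev_seq ev_seq ev_seq.
have [e1 q1 p1] := ev_partner (isT : 12 != 11) h5 h0 h6.
move: (ev (partner_cmd 12 6) s) e1 q1 p1 => s1 e1 q1 p1.
rewrite -e1 in h5 h0 h6 h7 hN.
have [e2 q2 p2] := ev_partner (isT : 13 != 11) h5 h0 h7.
move: (ev (partner_cmd 13 7) s1) e2 q2 p2 => s2 e2 q2 p2.
rewrite -e2 in h5 h0 h6 h7 hN.
have q q' : q' \notin [:: 12; 13] -> reg s2 q' = reg s q'.
  by rewrite !inE negb_or => /andP[n1 n2]; rewrite q2 // q1.
rewrite ev_if eval_and eval_not eval_and !eqb0 !negbK.
set s3 := if _ then _ else _.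
suff [hr h35 h3q] : [/\ peel_rel d s3 (peel_step f g t), reg s3 5 = reg s 5 &
    forall q', q' < 5 -> reg s3 q' = reg s q'].
  case: hr => [[a1 a2 a3] [a4 a5 a6 a7]]; rewrite ev_asg; split.
  - by split; split=> //=; rewrite upd_neq.
  - by rewrite /= upd_same h35.
  - by move=> q' hq; rewrite /= upd_neq ?h3q //; case: eqP hq => // ->.
have resc : [/\ peel_rel d (ev next_scan s2) (rescan t), reg (ev next_scan s2) 5 = reg s 5 &
    forall q', q' < 5 -> reg (ev next_scan s2) q' = reg s q'].
  rewrite /next_scan ev_seq !ev_asg /=; split.
  - by split; split=> //=; rewrite /upd /= q // ?r6 ?addn1.
  - by rewrite /upd /= q.
  - by move=> q' hq; rewrite /upd; do 5![case: q' hq => [|q'] hq; first by rewrite /= q].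
rewrite /s3 [eval (ELd _ _) _]/= [eval (EVar 12) _]/= [eval (EVar 13) _]/= q // r11 /peel_step.
case ec: (vert n (cur t)) => [v|]; last by rewrite hN.
have cE := vert_onat ec; rewrite cE h5; case vA: (v \in alive t); last exact: resc.
have x12 : reg s2 12 = onat (partner (alive t) f v) by rewrite q2 // (p1 v) // r11.
have x13 : reg s2 13 = onat (partner (alive t) g v) by rewrite (p2 v) // q1 // r11.
rewrite x12 x13.
have x11 : reg s2 11 = v.+1 by rewrite q // r11.
have pair w h : partner (alive t) h v = Some w ->
    reg s2 12 + reg s2 13 = w.+1 ->
    [/\ peel_rel d (ev remove_current s2)
         (PState (alive t :\ v :\ w) (onat (f w) + onat (g w) - v.+1) (scan t) (singles t)),
        reg (ev remove_current s2) 5 = reg s 5 &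
        forall q', q' < 5 -> reg (ev remove_current s2) q' = reg s q'].
  move=> /partnerP[hw wA] hsum; rewrite /remove_current !ev_seq ev_sto ev_asg ev_if.
  rewrite [eval _ _]/= hsum /= upd_same /= {1 3}/upd /= x11 hsum.
  split; last 2 first.
  - by rewrite /upd /= q.
  - by move=> q' hq; rewrite /upd; do 5![case: q' hq => [|q'] hq; first by rewrite /= q].
  split; split=> //=; rewrite /upd /=.
  - by rewrite /hupd !andbF h6 h7.
  - by rewrite q.
  - by rewrite q.
  - by apply: (@hupd5_alive (State (reg s2) _)); apply: hupd5_alive.
  - by move=> u; rewrite /hupd !andbF.
  - by move=> u; rewrite /hupd !andbF.
  - by move=> p hp; rewrite /hupd; case: ifP => // _; case: ifP => // _; apply: hN.
have single : reg s2 12 = 0 -> reg s2 13 = 0 ->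
    [/\ peel_rel d (ev remove_current s2)
         (PState (alive t :\ v) 0 (scan t) (singles t).+1),
        reg (ev remove_current s2) 5 = reg s 5 &
        forall q', q' < 5 -> reg (ev remove_current s2) q' = reg s q'].
  move=> z12 z13; rewrite /remove_current !ev_seq ev_sto ev_asg ev_if.
  rewrite [eval _ _]/= z12 z13 /= x11.
  split; last 2 first.
  - by rewrite /upd /= q.
  - by move=> q' hq; rewrite /upd; do 5![case: q' hq => [|q'] hq; first by rewrite /= q].
  split; split=> //=; rewrite /upd /=.
  - by rewrite q.
  - by rewrite q // r7 addn1 addnS.
  - exact: hupd5_alive.
  - by move=> u; rewrite /hupd !andbF.
  - by move=> u; rewrite /hupd !andbF.
  - by move=> p hp; rewrite /hupd; case: ifP => // _; apply: hN.
move: remove_current next_scan pair single resc {s3} => rc ns pair single resc.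
case ef: (partner (alive t) f v) => [w|]; case eg: (partner (alive t) g v) => [w'|].
- exact: resc.
- by apply: (pair w f); rewrite // x12 x13 ef eg addn0.
- by apply: (pair w' g); rewrite // x12 x13 ef eg.
- by apply: single; rewrite ?x12 ?x13 ?ef ?eg.
Qed.

Lemma peel_iter d s t k : peel_rel d s t ->
  [/\ peel_rel d (iter k (ev peel_cmd) s) (iter k (peel_step f g) t),
      reg (iter k (ev peel_cmd) s) 5 = reg s 5 - k &
      forall q, q < 5 -> reg (iter k (ev peel_cmd) s) q = reg s q].
Proof.
move=> h; elim: k => [|k [IH r5 rq]]; first by rewrite subn0.
have [h1 h2 h3] := ev_peel IH; rewrite !iterS; split=> //.
  by rewrite h2 r5; lia.
by move=> q hq; rewrite h3 ?rq.
Qed.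

End Peel.

(** * Correctness *)

Section Correctness.
Variables (n : nat) (G : tcgraph n) (es : seq ('I_n * 'I_n * bool)).
Hypothesis wfG : wf_tcgraph G.
Hypothesis valid : valid_edge_list G es.

Definition colored (c : bool) : {set {set 'I_n}} := if c then blue G else red G.

Lemma nbl_cat (L1 L2 : seq ('I_n * 'I_n * bool)) v c : nbl (L1 ++ L2) v c = nbl L1 v c ++ nbl L2 v c.
Proof. by rewrite /nbl map_cat flatten_cat. Qed.

Lemma mem_ends (x : 'I_n * 'I_n * bool) v c w :
  (w \in ends x v c) = (edge x.1.1 x.1.2 == edge v w) && (x.2 == c).
Proof.
rewrite /ends andbC; case: (x.2 == c) => //=; apply/idP/eqP => [|/edge_eq].
  rewrite mem_cat => /orP[]; case: eqP => // <-; rewrite inE => /eqP->//.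
  exact: edgeC.
by case=> -[-> ->]; rewrite mem_cat !eqxx !inE eqxx ?orbT.
Qed.

Lemma mem_nbl_seq (L : seq ('I_n * 'I_n * bool)) v c w :
  (w \in nbl L v c) = ((edge v w, c) \in [seq (edge x.1.1 x.1.2, x.2) | x <- L]).
Proof.
elim: L => [|x L IH] //; rewrite -cat1s nbl_cat mem_cat IH /= inE; congr (_ || _).
by rewrite /nbl /= cats0 mem_ends xpair_eqE eq_sym [c == _]eq_sym.
Qed.

Lemma mem_nbl v c w : (w \in nbl es v c) = (edge v w \in colored c).
Proof.
rewrite mem_nbl_seq; case: valid => _ hr hb.
by apply/idP/idP; rewrite /colored; case: (c) => /= h; by [apply/hb | apply/hr].
Qed.

Lemma colored_neq v w c : edge v w \in colored c -> v != w.
Proof.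
case: wfG => hr hb _ h; have : #|edge v w| = 2 by move: h; rewrite /colored; case: (c) => /= h; [apply: hb | apply: hr].
by rewrite cards2; case: eqP.
Qed.

Lemma edge_list_neq x : x \in es -> x.1.1 != x.1.2.
Proof.
move=> xe; apply: (@colored_neq _ _ x.2); rewrite -mem_nbl mem_nbl_seq.
by apply/mapP; exists x.
Qed.

Lemma nbl_uniq v c : uniq (nbl es v c).
Proof.
case: valid => + _ _; move: edge_list_neq; elim: es => [|x L IH] // hne /= /andP[hx hL].
rewrite -cat1s nbl_cat cat_uniq IH ?andbT //; last first.
  by move=> y yL; apply: hne; rewrite inE yL orbT.
rewrite /nbl /= cats0; apply/andP; split.
  have := hne x (mem_head _ _); rewrite /ends; case: (_ == c) => //.
  by case: (x.1.1 =P v) => [e1|_]; case: (x.1.2 =P v) => [e2|_] //=; rewrite e1 e2 eqxx.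
apply/hasPn => w; rewrite -/(nbl L v c) mem_nbl_seq => hw; rewrite mem_ends.
by apply/negP=> /andP[/eqP e1 /eqP e2]; rewrite e1 e2 hw in hx.
Qed.

Hypothesis noK3 : ~ has_mono_K3 G.
Hypothesis noP3 : ~ has_mono_P3 G.
Notation r := (nrel es false).
Notation b := (nrel es true).

Lemma nrelE c v w : nrel es c v w = (edge v w \in colored c).
Proof. exact: mem_nbl. Qed.

Lemma graph_mono_free : mono_free r b.
Proof.
have nsym c : symmetric (nrel es c) by move=> x y; rewrite !nrelE edgeC.
have nirr c : irreflexive (nrel es c).
  by move=> x; apply/negP; rewrite nrelE => /colored_neq; rewrite eqxx.
have disj : forall x y, r x y -> ~~ b x y.
  by case: wfG => _ _ hd x y; rewrite !nrelE /= => h; rewrite (disjointFr hd h).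
split=> // x y z; rewrite !nrelE /= => xy xz yz.
  have yx := xy; rewrite edgeC in yx.
  case rb: (edge y z \in red G :|: blue G).
    move: rb; rewrite inE => /orP[h|//]; exfalso; apply: noK3; left; exists y, x, z; split=> //.
    by rewrite yz (@colored_neq y x false) // (@colored_neq x z false).
  by exfalso; apply: noP3; left; exists y, x, z; split; rewrite ?rb.
have yx := xy; rewrite edgeC in yx.
case rb: (edge y z \in red G :|: blue G).
  move: rb; rewrite inE => /orP[//|h]; exfalso; apply: noK3; right; exists y, x, z; split=> //.
  by rewrite yz (@colored_neq y x true) // (@colored_neq x z true).
by exfalso; apply: noP3; right; exists y, x, z; split; rewrite ?rb.
Qed.
Let H := graph_mono_free.

Lemma nbl_size v c : size (nbl es v c) <= 2.
Proof.
have -> : size (nbl es v c) = deg (nrel es c) v.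
  by rewrite /deg cardsE /nrel; symmetry; apply/card_uniqP/nbl_uniq.
by case: c; [apply: deg_le2 (mono_free_swap H) | apply: deg_le2 H].
Qed.

Lemma nbl_take_size j v c : size (nbl (take j es) v c) <= 2.
Proof.
apply: leq_trans (nbl_size v c); rewrite -[X in _ <= size (nbl X v c)](cat_take_drop j es).
by rewrite nbl_cat size_cat leq_addr.
Qed.

(** Double counting: each edge is seen from both ends, and a vertex sees at most four. *)
Lemma size_edges : size es <= 2 * n.
Proof.
have hs : \sum_v (size (nbl es v false) + size (nbl es v true)) = 2 * size es.
  elim: es => [|x L IH]; first by rewrite big1.
  have step v : size (nbl (x :: L) v false) + size (nbl (x :: L) v true) =
      (v == x.1.1) + (v == x.1.2) + (size (nbl L v false) + size (nbl L v true)).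
    have nblS c : nbl (x :: L) v c = ends x v c ++ nbl L v c by [].
    rewrite !nblS !size_cat addnACA /ends; congr (_ + _).
    rewrite ![v == _]eq_sym.
    by case: (x.2); rewrite /= size_cat ?addn0; case: (x.1.1 == v); case: (x.1.2 == v).
  rewrite (eq_bigr _ (fun v _ => step v)) big_split IH /= [RHS]mulnS; congr (_ + _).
  by rewrite big_split /= -!big_mkcond /= !big_pred1_eq.
have : \sum_v (size (nbl es v false) + size (nbl es v true)) <= \sum_(v < n) 4.
  by apply: leq_sum => v _; apply: (leq_add (nbl_size v false) (nbl_size v true)).
by rewrite hs sum_nat_const card_ord; lia.
Qed.

Lemma lone_nbrP c v w : lone_nbr es c v = Some w <-> lone (nrel es c) v w.
Proof.
rewrite /lone_nbr; split.
  case e: (nbl es v c) => [|x [|? ?]] // [<-]; apply/loneP; rewrite /nrel e mem_head.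
  by split=> // z; rewrite inE => /eqP.
case/loneP; rewrite /nrel; have := nbl_uniq v c.
case: (nbl es v c) => [|x [|y l]] //= hu.
  by rewrite inE => /eqP->.
move=> _ hall; have e1 := hall x (mem_head _ _).
have e2 : y = w by apply: hall; rewrite !inE eqxx orbT.
by move: hu; rewrite e1 e2 mem_head.
Qed.

Notation Cs := [set v | center r b v].

Lemma lone_nbr_sym c v w : v \in Cs -> lone_nbr es c v = Some w -> lone_nbr es c w = Some v.
Proof.
rewrite inE => /centerP[x [y /and3P[vx vy nxy]]] /lone_nbrP l; apply/lone_nbrP.
case: c l => /loneP[vw L].
  have e := L _ vy; rewrite e in nxy.
  by apply: (conflict_lone (mono_free_swap H) vw vx); rewrite adj_swap.
have e := L _ vx; rewrite e in nxy.
by apply: (conflict_lone H vw vy); rewrite (adj_sym H).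
Qed.

Lemma lone_nbr_irr c v : lone_nbr es c v <> Some v.
Proof. by move=> /lone_nbrP/loneP[]; rewrite nrelE => /colored_neq; rewrite eqxx. Qed.

Lemma link_linked v w : link Cs (lone_nbr es false) (lone_nbr es true) v w = linked r b v w.
Proof.
rewrite /link /linked !inE; congr [&& _, _ & _ || _]; apply/eqP/idP; move/lone_nbrP; exact.
Qed.

Lemma bow_unlinked v w : bow r b v -> ~~ linked r b v w.
Proof.
case/and3P=> _ d1 d2; apply/negP=> /and3P[_ _].
have key s : lone s v w -> ~~ (1 < deg s v).
  case/loneP=> _ L; rewrite -leqNgt /deg -(cards1 w); apply: subset_leq_card.
  by apply/subsetP=> z; rewrite !inE => /L->.
by case/orP=> /key; rewrite ?d1 ?d2.
Qed.

Lemma hits_of_solution (S : {set {set 'I_n}}) :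
  ~ has_bicolored_P3 (red G :\: S) (blue G :\: S) -> hits r b S.
Proof.
move=> hS v x y /and3P[vx vy nxy]; apply/negPn; rewrite negb_or; apply/negP=> /andP[nx ny].
apply: hS; exists x, v, y; move: vx vy nxy; rewrite /adj !nrelE /= => vx vy nxy.
split.
- apply: contraTneq vy => <-; apply: contraTN vx => vx.
  by have := mf_disj H (x := v) (y := x); rewrite !nrelE /= => h; apply/negP=> /h; rewrite vx.
- by rewrite inE edgeC nx.
- by rewrite inE ny.
- by move: nxy; rewrite !inE !negb_or => /andP[/negbTE-> /negbTE->]; rewrite !andbF.
Qed.

Definition run := peel_run Cs (lone_nbr es false) (lone_nbr es true).

Lemma sum_cost : \sum_v cost es v = #|Cs| + 2 * #|[set v | bow r b v]|.
Proof.
rewrite (eq_bigr (fun v => center r b v + 2 * bow r b v)) => [|v _]; last first.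
  by rewrite /cost /bow; case: (center _ _ _); rewrite ?mul1n ?mul0n.
rewrite big_split /= -big_distrr /= -!big_mkcond -!sum1_card.
by congr (_ + 2 * _); apply: eq_bigl => v; rewrite inE.
Qed.

Lemma bp3d_yes_iff k :
  bp3d_yes G k <-> \sum_v cost es v + singles run <= 2 * k.
Proof.
have := peel_run_correct (@lone_nbr_sym false) (@lone_nbr_sym true)
  (@lone_nbr_irr false) (@lone_nbr_irr true).
rewrite -/run => -[y [T [E [[y2 yl yu ys] [TC hE hT cE]]]]].
rewrite sum_cost; set Bs := [set v | bow r b v]; split.
  case=> S [_ cS hS]; apply: leq_trans (_ : 2 * #|S| <= _); last by rewrite leq_mul2l.
  have le : \sum_(v | center r b v) y v * (1 + bow r b v) <= 2 * #|S|.
    apply: packing_bound => //; first exact: hits_of_solution.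
    by move=> v w l; apply: yl; rewrite link_linked.
  apply: leq_trans le.
  under eq_bigr => v _ do rewrite mulnDr muln1.
  rewrite big_split /= addnAC; apply: leq_add.
    by rewrite -ys; apply: eq_leq; apply: eq_bigl => v; rewrite inE.
  rewrite mulnC -sum_nat_const big_mkcond [X in _ <= X]big_mkcond /=; apply: leq_sum => v _.
  case: (boolP (center r b v)) => [cv|ncv]; last first.
    by rewrite /Bs inE /bow (negbTE ncv).
  rewrite inE; case bv: (bow r b v); rewrite ?muln0 ?if_same // muln1.
  (* A bow has no link and hence weight 2, which accounts for its extra cost in the doubled sum. *)
  by rewrite yu ?inE // => w; rewrite link_linked bow_unlinked.
(* Intersecting with the edge set yields the required inclusion and changes nothing about which
   edges remain. *)
move=> le; pose S := deletion r b E T; exists (S :&: (red G :|: blue G)).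
have hE' e : e \in E -> exists v w, linked r b v w /\ e = edge v w.
  by move=> /hE[v [w [l ee]]]; exists v, w; rewrite -link_linked.
have hT' v : v \in T -> center r b v by move=> /(subsetP TC); rewrite inE.
have hC v : center r b v -> v \notin T -> exists2 w, linked r b v w & edge v w \in E.
  move=> cv vT; have vC : v \in Cs by rewrite inE.
  by have [w l ew] := hT v vC vT; exists w; rewrite -?link_linked.
split; first exact: subsetIr.
  apply: leq_trans (subset_leq_card (subsetIl _ _)) _.
  have := @deletion_card n r b E T H hT'; rewrite -/S -/Bs.
  have aux (s e t bb c z : nat) : 2 * (e + t) <= c + z -> c + 2 * bb + z <= 2 * k ->
    s <= e + t + bb -> s <= k by lia.
  exact: aux cE le.
case=> u [v [w [uw uv vw nuw]]].
have col (R : {set {set 'I_n}}) : R \subset red G :|: blue G -> forall e,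
    (e \in R :\: (S :&: (red G :|: blue G))) = (e \in R) && (e \notin S).
  move=> /subsetP sub e; rewrite !inE negb_and andbC; case eR: (e \in R) => //=.
  by move: (sub _ eR); rewrite inE => ->; rewrite orbF.
move: nuw; rewrite in_setU negb_or => /andP[nur nub].
have colr := col (red G) (subsetUl _ _); have colb := col (blue G) (subsetUr _ _).
rewrite colr in uv; rewrite colr in nur; rewrite colb in vw; rewrite colb in nub.
case/andP: uv => uv nuv; case/andP: vw => vw nvw.
have ruv : r u v by rewrite nrelE.
have bvw : b v w by rewrite nrelE.
have /andP[h hS] := no_bicolored H hE' hT' hC uw ruv bvw nuv nvw.
rewrite /adj !nrelE /= in h; rewrite -/S in hS.
by move: nur nub; rewrite hS !andbT; case/orP: h => ->.
Qed.

End Correctness.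

(** * Assembling the program *)

Definition setup_read : cmd :=
  CSeq (CAsg 3 (ELd (EVar 2) 0))
 (CSeq (CAsg 4 (ELd (ESub (EVar 2) (ECst 1)) 0))
 (CSeq (CSto (ECst 3) 0 (ELd (ESub (EVar 2) (ECst 2)) 0))
 (CSeq (CAsg 5 (EVar 2)) (CAsg 6 (ECst 3))))).

Definition setup_inspect : cmd :=
  CSeq (CAsg 5 (EVar 3)) (CSeq (CAsg 6 (ECst 1)) (CAsg 7 (ECst 0))).

Definition setup_peel : cmd :=
  CSeq (CAsg 5 (EAdd (EAdd (EVar 3) (EVar 3)) (ECst 1)))
 (CSeq (CAsg 6 (ECst 1)) (CAsg 11 (ECst 0))).

(** By truncation the result is nonzero exactly when register 7 is at most [2 * k]. *)
Definition answer : cmd :=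
  CAsg 0 (ESub (ECst 1) (ESub (EVar 7) (EAdd (EVar 4) (EVar 4)))).

Definition main : seq stmt :=
  [:: SCmd setup_read; SLoop (EVar 5) read_edge;
      SCmd setup_inspect; SLoop (EVar 5) inspect_vertex;
      SCmd setup_peel; SLoop (EVar 5) peel_cmd; SCmd answer].

Definition main_code : seq instr := compile_stmts main 29.

(** Without edges the base [64 * mem[2]] would be 0 and the heap would overlap the registers, so
    that case is answered yes at once. Four instructions here and 25 in [prologue] give the position
    29. *)
Definition with_prologue (code : seq instr) : seq instr :=
  [:: IJz 2 2; IJmp 4; IConst 0 1; IHalt] ++ prologue ++ code ++ [:: IHalt].

Lemma with_prologue_at code (P := with_prologue code) :
  [/\ nth IHalt P 0 = IJz 2 2, nth IHalt P 1 = IJmp 4, nth IHalt P 2 = IConst 0 1 &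
      nth IHalt P 3 = IHalt] /\
  [/\ code_at P 4 prologue, code_at P 29 code & nth IHalt P (29 + size code) = IHalt].
Proof.
split=> //.
have cP : code_at P 0 P by exact: (ex_intro _ [::] (ex_intro _ [::] (conj (esym (cats0 _)) erefl))).
have [_ rest] := @code_at_cat P 0 [:: IJz 2 2; IJmp 4; IConst 0 1; IHalt]
  (prologue ++ code ++ [:: IHalt]) cP.
have [pro_at rest'] := code_at_cat rest.
have [main_at halt_at] := code_at_cat rest'.
by split=> //; case: (code_at_cons halt_at).
Qed.

Lemma encode_edge n k (es : seq ('I_n * 'I_n * bool)) x0 j : j < size es ->
  [/\ nth 0 (encode k es) (3 + 3 * j) = (nth x0 es j).1.1,
      nth 0 (encode k es) (3 + 3 * j + 1) = (nth x0 es j).1.2 &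
      nth 0 (encode k es) (3 + 3 * j + 2) = (nth x0 es j).2].
Proof.
rewrite /encode; set cells := fun x : 'I_n * 'I_n * bool => [:: val x.1.1; val x.1.2; nat_of_bool x.2].
have key i L : i < size L -> forall q, q < 3 ->
    nth 0 (flatten (map cells L)) (3 * i + q) = nth 0 (cells (nth x0 L i)) q.
  elim: L i => [|x L IH] [|i] // lt q hq.
    by rewrite /=; case: q hq => [|[|[|]]].
  by rewrite mulnS -addnA; exact: IH.
move=> lt; split.
- by rewrite -[3 * j]addn0; exact: (key j es lt 0 isT).
- by rewrite -addnA; exact: (key j es lt 1 isT).
- by rewrite -addnA; exact: (key j es lt 2 isT).
Qed.

Lemma encode_size n k (es : seq ('I_n * 'I_n * bool)) :
  size (encode k es) = 3 + 3 * size es.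
Proof.
rewrite size_cat /=; congr (_ + _).
by elim: es => // x L IH; rewrite /= IH mulnS.
Qed.

Lemma run_main_answer N1 N2 N3 s t :
  t = iter N3 (ev peel_cmd) (ev setup_peel (iter N2 (ev inspect_vertex)
        (ev setup_inspect (iter N1 (ev read_edge) (ev setup_read s))))) ->
  reg (run_stmts (zip main [:: 0; N1; 0; N2; 0; N3; 0]) s) 0 =
  1 - (reg t 7 - (reg t 4 + reg t 4)).
Proof.
have runS x l s' : run_stmts (x :: l) s' = run_stmts l (run_stmt x s') by [].
have runC c N s' : run_stmt (SCmd c, N) s' = ev c s' by [].
have runL e c N s' : run_stmt (SLoop e c, N) s' = iter N (ev c) s' by [].
have run0 s' : run_stmts [::] s' = s' by [].
have zipS (x : stmt) (N : nat) l l' : zip (x :: l) (N :: l') = (x, N) :: zip l l' by [].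
have zip0 : zip (T := nat) (Nil stmt) [::] = [::] by [].
move=> et; rewrite /main !zipS zip0 !runS run0 !(runC, runL) -et.
by rewrite /answer ev_asg; move: t {et} => t.
Qed.

Lemma eval_var x s : eval (EVar x) s = reg s x.
Proof. by []. Qed.

Lemma run_main n (G : tcgraph n) k (es : seq ('I_n * 'I_n * bool)) s B :
  wf_tcgraph G -> valid_edge_list G es -> ~ has_mono_K3 G -> ~ has_mono_P3 G ->
  0 < size es ->
  B = 64 * size es -> reg s 2 = B -> heap s B 0 = n -> heap s (B - 1) 0 = k ->
  heap s (B - 2) 0 = nth 0 (encode k es) 3 ->
  (forall j, 4 <= j < 3 + 3 * size es -> heap s j 0 = nth 0 (encode k es) j) ->
  (forall p f, 0 < f < 8 -> heap s p f = 0) ->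
  exists Ns, [/\ size Ns = size main, all (fun N => N <= (2 * n).+1) Ns,
    stmts_ok (zip main Ns) s &
    (reg (run_stmts (zip main Ns) s) 0 != 0 <-> bp3d_yes G k)].
Proof.
move=> wfG valid noK3 noP3 m0 eB rB hn hk h3 hin hz.
have mn := size_edges wfG valid noK3 noP3.
have [x0 _] : exists x0, x0 \in es.
  by case: (es) m0 => [|x0 L] // _; exists x0; apply: mem_head.
pose s1 := ev setup_read s.
have [r13 r14 r15 r16] : [/\ reg s1 3 = n, reg s1 4 = k, reg s1 5 = B & reg s1 6 = 3].
  by rewrite /s1 /= /upd /= rB hn hk.
rewrite eB in r15.
(* The copy of input cell 3 was taken after the cell had become a register; its saved value is put
   back. *)
have h1 : heap s1 = hupd (heap s) 3 0 (nth 0 (encode k es) 3).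
  by rewrite /s1 /= /upd /= rB h3.
have hin1 i : 3 <= i < 3 + 3 * size es -> heap s1 i 0 = nth 0 (encode k es) i.
  move=> hi; rewrite h1 /hupd andbT; case: eqP => [->//|ne]; apply: hin; lia.
have hz1 p q : 0 < q < 8 -> heap s1 p q = 0.
  by move=> hq; rewrite h1 /hupd; case: q hq => // q hq; rewrite andbF hz.
have hin2 j : j < size es ->
     [/\ heap s1 (3 + 3 * j) 0 = (nth x0 es j).1.1,
         heap s1 (3 + 3 * j + 1) 0 = (nth x0 es j).1.2 &
         heap s1 (3 + 3 * j + 2) 0 = (nth x0 es j).2].
  move=> lt; have [<- <- <-] := encode_edge k x0 lt.
  by split; apply: hin1; clear -lt; lia.
have read i (le : i <= size es) := @read_edges_inv n es x0 s1 i le (edge_list_neq wfG valid)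
  (nbl_take_size wfG valid noK3 noP3) r16 r15 hin2 hz1.
have ok1 : stmt_ok (SLoop (EVar 5) read_edge, size es) s1.
  split=> [i lt|].
    have [[_ e _ _] _] := read i (ltnW lt).
    by rewrite eval_var e muln_eq0 subn_eq0 -ltnNge.
  by have [[_ e _ _] _] := read _ (leqnn _); rewrite subnn muln0 in e; exact: e.
have [[_ _ r2 S2] [_ z2 n2]] := read _ (leqnn _); rewrite take_size in S2.
pose s2 := iter (size es) (ev read_edge) s1; rewrite -/s2 in r2 S2 z2 n2.
have r23 : reg s2 3 = n by rewrite r2.
have r24 : reg s2 4 = k by rewrite r2.
pose s3 := ev setup_inspect s2.
have [r33 r34 [r35 r36 r37] h3'] : [/\ reg s3 3 = n, reg s3 4 = k,
    [/\ reg s3 5 = n, reg s3 6 = 1 & reg s3 7 = 0] & heap s3 = heap s2].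
  by rewrite /s3 /= /upd /= r23 r24.
have S3 : slots_ok es (heap s3) by rewrite h3'.
have z3 p q : 4 < q < 8 -> heap s3 p q = 0 by rewrite h3'; apply: z2.
have insp i (le : i <= n) := inspect_inv (nbl_uniq wfG valid) (nbl_size wfG valid noK3 noP3)
  le S3 r36 r35 r37 z3.
have ok2 : stmt_ok (SLoop (EVar 5) inspect_vertex, n) s3.
  split=> [i lt|].
    have [[_ e _ _ _] _] := insp i (ltnW lt).
    by rewrite eval_var e subn_eq0 -ltnNge.
  by have [[_ e _ _ _] _] := insp _ (leqnn _); rewrite subnn in e; exact: e.
have [[_ _ r47 r4 _] [_ i4 n4]] := insp _ (leqnn _).
pose s4 := iter n (ev inspect_vertex) s3; rewrite -/s4 in r47 r4 i4 n4.
have r43 : reg s4 3 = n by rewrite r4.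
have r44 : reg s4 4 = k by rewrite r4.
pose s5 := ev setup_peel s4.
have [r54 r55 [r56 r57 r511] h5] : [/\ reg s5 4 = k, reg s5 5 = (2 * n).+1,
    [/\ reg s5 6 = 1, reg s5 7 = reg s4 7 & reg s5 11 = 0] & heap s5 = heap s4].
  by rewrite /s5 /= /upd /= r43 r44 addn1 mul2n addnn.
pose Cs := [set v | center (nrel es false) (nrel es true) v].
have rel : peel_rel (lone_nbr es false) (lone_nbr es true) (\sum_v cost es v) s5
    (PState Cs 0 1 0).
  split; split=> //.
  - by rewrite r57 r47 [singles _]/= addn0; apply: eq_bigl => v; rewrite ltn_ord.
  - by move=> v; rewrite h5 i4 // [alive _]/= inE.
  - by move=> v; rewrite h5 i4.
  - by move=> v; rewrite h5 i4.
  - by move=> p hp; rewrite h5 n4 // z3.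
have peel i := peel_iter i rel.
have ok3 : stmt_ok (SLoop (EVar 5) peel_cmd, (2 * n).+1) s5.
  split=> [i lt|].
    by have [_ e _] := peel i; rewrite eval_var e r55 subn_eq0 -ltnNge.
  by have [_ e _] := peel (2 * n).+1; rewrite r55 subnn in e; exact: e.
have [[[_ _ r67] _] _ r6] := peel (2 * n).+1.
pose s6 := iter (2 * n).+1 (ev peel_cmd) s5; rewrite -/s6 in r67 r6.
have r64 : reg s6 4 = k by rewrite r6.
exists [:: 0; size es; 0; n; 0; (2 * n).+1; 0]; split=> //.
- by apply/and5P; split=> //=; rewrite ?mn ?(leq_trans mn) //; lia.
rewrite (bp3d_yes_iff wfG valid noK3 noP3).
rewrite (@run_main_answer _ _ _ _ s6 erefl) r64 r67 /run /peel_run -/Cs.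
by clear; move: (_ + _) => d; split; lia.
Qed.

(* There is a single RAM program P and a constant c such that on every
   instance (G,k) with no monochromatic K3 and no monochromatic induced P3,
   P halts within c*(n+1) steps and answers (mem[0] != 0) exactly when
   (G,k) is a yes-instance of Bicolored P3 Deletion. *)
Theorem theorem3 :
  exists (P : seq instr) (c : nat),
    forall (n : nat) (G : tcgraph n) (k : nat) (es : seq ('I_n * 'I_n * bool)),
      wf_tcgraph G -> valid_edge_list G es ->
      ~ has_mono_K3 G -> ~ has_mono_P3 G ->
      exists fin : config,
        exec P (c * n.+1) (init (encode k es)) = Some fin /\
        (cfg_mem fin 0 != 0 <-> bp3d_yes G k).
Proof.
(* The relocation takes at most [10 * B + 16] steps with [B <= 128 * n], which 1400 absorbs; the
   statements take at most [2 * n + 2] times the size of [main_code]. *)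
exists (with_prologue main_code), (1400 + 2 * size main_code) => n G k es wfG valid noK3 noP3.
have [[i0 i1 i2 i3] [pro_at main_at halt_at]] := with_prologue_at main_code.
move: (with_prologue main_code) i0 i1 i2 i3 pro_at main_at halt_at => P i0 i1 i2 i3 pro_at main_at halt_at.
have [m0|m0] := posnP (size es).
  exists (Cfg 3 (upd (fun i => nth 0 (encode k es) i) 0 1)).
  split.
    have [u le hu] : reach_le P 2 (init (encode k es))
        (Cfg 3 (upd (fun i => nth 0 (encode k es) i) 0 1)).
      rewrite /init; instr_step; rewrite [nth 0 _ 2]/= m0 eqxx; instr_step.
      exact: reach_le_refl.
    apply: exec_halt hu _ _; first by rewrite /step i3.
    by apply: leq_trans le _; rewrite mulnDl; lia.
  split=> // _; exists set0; split; rewrite ?sub0set ?cards0 //.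
  case=> u [v [w [_ + _ _]]]; rewrite inE => /andP[_ uv].
  have [_ hr _] := valid; have := (hr (edge u v)).2 uv.
  by move/eqP: m0; rewrite size_eq0 => /eqP->.
pose M i := nth 0 (encode k es) i.
have M2 : M 2 = size es by [].
have Mz i : 3 + 3 * M 2 <= i -> M i = 0.
  by move=> le; rewrite /M nth_default // encode_size.
have Mm : 0 < M 2 by rewrite M2.
have [m1 [r1 b1 [hB hB1 hB2] hcell hzero]] := prologueP pro_at Mm Mz.
set B := 64 * M 2 in r1 b1 hB hB1 hB2 hcell hzero.
pose s := State m1 (fun p f => m1 (B + 8 * p + f)).
have rep : represents B m1 s by split.
have B64 : 64 <= B by rewrite /B; clear -Mm; lia.
have [||||||Ns [sN aN okN ans]] := @run_main n G k es s B wfG valid noK3 noP3 m0 erefl.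
- exact: b1.
- by rewrite /= addn0 hB.
- by rewrite /= addn0 hB1.
- by rewrite /= addn0 hB2.
- by move=> j hj; rewrite /= addn0 hcell.
- by move=> p f hf; apply: hzero.
have eN : map fst (zip main Ns) = main by apply: unzip1_zip; rewrite sN.
have wN : all wf_stmt (map fst (zip main Ns)) by rewrite eN.
have lN : all (fun x => x.2 <= (2 * n).+1) (zip main Ns).
  have -> : all (fun x : stmt * nat => x.2 <= (2 * n).+1) (zip main Ns) =
      all (fun N => N <= (2 * n).+1) (map snd (zip main Ns)) by rewrite all_map.
  by rewrite [map snd _]unzip2_zip // sN.
have cN : code_at P 29 (compile_stmts (map fst (zip main Ns)) 29) by rewrite eN; exact: main_at.
have [m2 r2 [_ hreg _]] := compile_stmtsP B64 wN lN okN rep cN.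
rewrite eN -/main_code in r2; move: (size main_code) halt_at r2 => K halt_at r2.
exists (Cfg (29 + K) m2); split; last by rewrite [cfg_mem _ _]/= hreg.
have [u le hu] : reach_le P (2 + (10 * B + 16 + (2 * n).+2 * K))
    (init (encode k es)) (Cfg (29 + K) m2).
  apply: (@reach_le_trans _ 2 (10 * B + 16 + (2 * n).+2 * K) _ _ (Cfg 4 M)) => //.
    rewrite /init; instr_step; rewrite [nth 0 _ 2]/= (gtn_eqF m0); instr_step.
    exact: reach_le_refl.
  exact: reach_le_trans r1 r2.
apply: exec_halt hu _ _.
  by rewrite /step halt_at.
have mn := size_edges wfG valid noK3 noP3.
have hB' : B <= 128 * n by rewrite /B M2; clear -mn; lia.
apply: leq_trans le _; clear -hB'; rewrite mulnDl.
have -> : 2 * K * n.+1 = (2 * n).+2 * K by lia.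
by lia.
Qed.
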